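(* For a regular smooth plane curve, the curvature function $k=k(s)$ and the signature $\sigma$ are the complete affine invariants (under orientation-preserving affine transformations). All the differential invariants are functions of $k(s)$ and its derivatives with respect to $s$.
   Context: $A^2$ is the real affine plane with affine coordinates $(x,y)$; an orientation-preserving affine transformation is a map $Z\mapsto LZ+v$ with $L\in GL_2(\mathbb R)$, $\det L>0$, $v\in\mathbb R^2$. Subscripts $x$ denote derivatives of $y(x)$. A smooth curve $y=y(x)$ is regular if $S_1=y_{xx}\neq0$ and $S_2=3y_{xx}y_{xxxx}-5y_{xxx}^2\neq0$ at all of its points. For a regular curve, the signature is $\sigma=\mathrm{sgn}(S_2)\in\{1,-1\}$; the arc parameter $s$, determined up to an additive constant, is a primitive of the invariant arc element $ds=\frac{|S_2|^{1/2}}{\sqrt3\,y_{xx}}dx$, so $\frac{d}{ds}=\frac{\sqrt3\,y_{xx}}{|S_2|^{1/2}}\frac{d}{dx}$; and the curvature is $$k=\frac{\sqrt3\,(9y_{xx}^2y_{xxxxx}-45y_{xx}y_{xxx}y_{xxxx}+40y_{xxx}^3)}{3|S_2|^{3/2}}.$$ That $k(s)$ and $\sigma$ are complete invariants means that they are invariant and determine a regular curve up to orientation-preserving affine transformation. The $r$-jet of a curve $y=y(x)$ at a point has coordinates $(x,y,y_x,y_{xx},\dots)$, up to the $r$-th derivative. The transformations act on curves and hence on jets; a differential invariant is a smooth real-valued function of $r$-jets of regular curves (for some $r\ge0$) that is invariant under this action.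
   Formalization: The second sentence is stated for each fixed signature σ: the function of k and its derivatives may depend on σ, since sgn(S_2) is itself a differential invariant not determined by k (ellipses and hyperbolas both have k = 0 but opposite σ). *)

(* Defs.v *)
From HB Require Import structures.
From mathcomp Require Import all_boot all_order all_algebra.
From mathcomp Require Import all_classical all_reals all_analysis.

Set Implicit Arguments.
Unset Strict Implicit.
Unset Printing Implicit Defensive.

Import Order.TTheory GRing.Theory Num.Theory.
Import numFieldNormedType.Exports.

Local Open Scope classical_set_scope.
Local Open Scope ring_scope.

(* The functions below are total; only their values on the relevant (open)
   domain are meaningful, and all the derivatives used there are local. *)

Definition smooth_curve (R : realType) (D : set R) (y : R -> R) : Prop :=
  forall (n : nat) (x : R), D x -> derivable (derive1n n y) x 1.

(* For an open set U this is the usual C^oo on U: differentiability of every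
   iterated partial derivative forces the continuity of all of them. At a point
   of a non-open U the derivatives are those of the ambient space. *)
Definition smooth_on (R : realType) (n : nat) (U : set 'rV[R]_n)
    (F : 'rV[R]_n -> R) : Prop :=
  forall (vs : seq 'rV[R]_n) (p : 'rV[R]_n), U p ->
    differentiable (foldr (fun v (G : 'rV[R]_n -> R) => 'D_v G) F vs) p.

Definition pt (R : realType) (a b : R) : 'cV[R]_2 :=
  \col_(i < 2) (if val i == 0%N then a else b).

Definition graph (R : realType) (D : set R) (y : R -> R) : set 'cV[R]_2 :=
  [set pt x (y x) | x in D].

Definition affine (R : realType) (L : 'M[R]_2) (v Z : 'cV[R]_2) : 'cV[R]_2 :=
  L *m Z + v.

Definition S1 (R : realType) (y : R -> R) (x : R) : R := derive1n 2 y x.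

Definition S2 (R : realType) (y : R -> R) (x : R) : R :=
  3 * derive1n 2 y x * derive1n 4 y x - 5 * derive1n 3 y x ^+ 2.

Definition regular (R : realType) (D : set R) (y : R -> R) : Prop :=
  [/\ [/\ open D, is_interval D & D !=set0],
      smooth_curve D y &
      forall x : R, D x -> S1 y x != 0 /\ S2 y x != 0].

(* On a regular curve this is constant, the domain being connected. *)
Definition signature (R : realType) (y : R -> R) (x : R) : R :=
  Num.sg (S2 y x).

Definition arc_element (R : realType) (y : R -> R) (x : R) : R :=
  Num.sqrt `|S2 y x| / (Num.sqrt 3 * derive1n 2 y x).

Definition arc_parameter (R : realType) (D : set R) (y s : R -> R) : Prop :=
  forall x : R, D x -> is_derive x 1 s (arc_element y x).

(* The operator d/ds, acting on functions of x. *)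
Definition dds (R : realType) (y h : R -> R) (x : R) : R :=
  Num.sqrt 3 * derive1n 2 y x / Num.sqrt `|S2 y x| * derive1 h x.

Definition curvature (R : realType) (y : R -> R) (x : R) : R :=
  Num.sqrt 3 *
    (9 * derive1n 2 y x ^+ 2 * derive1n 5 y x
     - 45 * derive1n 2 y x * derive1n 3 y x * derive1n 4 y x
     + 40 * derive1n 3 y x ^+ 3)
  / (3 * Num.sqrt `|S2 y x| ^+ 3).

(* K, on its domain J = s(D), is the curvature as a function k(s) of the arc
   parameter s. Since s is only determined up to an additive constant, so is
   the argument of K. *)
Definition curvature_function (R : realType) (D : set R) (y s : R -> R)
    (J : set R) (K : R -> R) : Prop :=
  [/\ arc_parameter D y s, s @` D = J &
      forall x : R, D x -> K (s x) = curvature y x].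

Definition same_signature (R : realType) (D1 : set R) (y1 : R -> R)
    (D2 : set R) (y2 : R -> R) : Prop :=
  forall x1 x2 : R, D1 x1 -> D2 x2 -> signature y1 x1 = signature y2 x2.

(* Coordinates (x, y, y_x, ..., y_(x^r)). *)
Definition jet (R : realType) (r : nat) (y : R -> R) (x : R) : 'rV[R]_r.+2 :=
  \row_(i < r.+2) (if val i is j.+1 then derive1n j y x else x).

Definition regular_jets (R : realType) (r : nat) : set 'rV[R]_r.+2 :=
  [set p | exists (D : set R) (y : R -> R) (x : R),
     [/\ regular D y, D x & p = jet r y x]].

(* The transformations act on r-jets through the curves representing them. The
   image of a graph need not be a graph, but every r-jet whose image is again
   the r-jet of a graph is covered by shrinking the domain of the curve. *)
Definition differential_invariant (R : realType) (r : nat)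
    (F : 'rV[R]_r.+2 -> R) : Prop :=
  smooth_on (@regular_jets R r) F /\
  forall (D1 : set R) (y1 : R -> R) (D2 : set R) (y2 : R -> R)
         (L : 'M[R]_2) (v : 'cV[R]_2) (x1 x2 : R),
    regular D1 y1 -> regular D2 y2 -> 0 < \det L ->
    affine L v @` graph D1 y1 = graph D2 y2 ->
    D1 x1 -> D2 x2 -> affine L v (pt x1 (y1 x1)) = pt x2 (y2 x2) ->
    F (jet r y1 x1) = F (jet r y2 x2).

(* The row (k, dk/ds, ..., d^(m-1)k/ds^(m-1)) at the point of abscissa x. *)
Definition curvature_derivatives (R : realType) (m : nat) (y : R -> R) (x : R) :
    'rV[R]_m :=
  \row_(i < m) iter (val i) (dds y) (curvature y) x.

(* Main.v *)
Require Import Defs.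
From mathcomp Require Import all_boot all_order all_algebra.
From mathcomp Require Import all_classical all_reals all_analysis.
From mathcomp Require Import ring lra.
Import Order.TTheory GRing.Theory Num.Theory.
Import numFieldNormedType.Exports.
Set Implicit Arguments.
Unset Strict Implicit.
Unset Printing Implicit Defensive.

Local Open Scope classical_set_scope.
Local Open Scope ring_scope.

(** The proof is the method of the moving frame. To each point of a regular
    curve one attaches two vectors built from its 4-jet: the tangent vector
    e1 = (dx/ds, dy/ds), with components [speed] and [tangent_y], and a multiple
    e2 of the affine normal, with components [normal_x] and [normal_y]. The
    scaling of e2 is chosen so that an affine map with linear part L and positive
    determinant carries e1, e2 to L e1, L e2 ([image_frame]); in particular ds is
    invariant. The frame satisfies
      de1/ds = - (sigma k / 2) e1 + e2,
      de2/ds = - (sigma / 3) e1 - sigma k e2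
    ([frenet_equations]), whose coefficients involve nothing but k and sigma.
    Comparing these equations for a curve and for its image shows that k is
    invariant ([image_curvature]), and hence so are its derivatives in s.

    Conversely, if two curves have the same k(s) and sigma, then after the change
    of parameter s2^-1 o s1 their frames solve the same linear system. The matrix
    carrying one frame to the other is constant: by Cramer's rule its entries are
    quotients of determinants of pairs of solutions, and all these determinants
    satisfy one and the same equation u' = m u ([frenet_solution]). Integrating
    the tangent vectors gives the translation ([curvature_function_congruent]).

    For differential invariants, the affine map whose linear part is the inverse
    of the frame brings any jet to the origin with y = y_x = 0, y_xx = 1,
    y_xxx = 0, y_xxxx = sigma. The derivative d^j k/ds^j has the form
    c y^(5+j) + (terms of lower order), with c = 1 at such normalized jets; so the
    higher coordinates of a normalized jet are polynomials in k, k_s, k_ss, and so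
    on, found recursively ([normal_jetE]). An invariant F therefore equals its
    value at the normalized jet, F o [normal_row], a function of k and its
    derivatives ([jet_normalization]). Any prescribed values of k, k_s, ... give
    the jet of some regular curve ([normal_row_regular]), so this function is
    defined and smooth on the whole space. *)

(** * Calculus on open intervals *)

Lemma near_open (R : realType) (D : set R) (x : R) :
  open D -> D x -> \forall t \near x, D t.
Proof. by move=> oD Dx; exact: open_nbhs_nbhs. Qed.

(** Derivatives are local: all functions below are controlled on an open domain
    only, and this is how identities on that domain are differentiated. *)
Lemma is_derive_eq_on (R : realType) (D : set R) (f g : R -> R) (x l : R) :
  open D -> (forall t, D t -> f t = g t) -> D x ->
  is_derive x 1 f l -> is_derive x 1 g l.
Proof.
move=> oD fg Dx; apply: near_eq_is_derive.
by apply: filterS (near_open oD Dx) => t /fg.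
Qed.

Lemma is_derive_continuous (R : realType) (f : R -> R) (x l : R) :
  is_derive x 1 f l -> {for x, continuous f}.
Proof.
by move=> [fx _]; apply/differentiable_continuous/derivable1_diffP.
Qed.

Lemma within_continuous_itv (R : realType) (D : set R) (f f' : R -> R)
    (a b : R) :
  is_interval D -> (forall x, D x -> is_derive x 1 f (f' x)) ->
  D a -> D b -> {within `[a, b], continuous f}.
Proof.
move=> iD df Da Db; apply: continuous_subspace_itv => x; rewrite in_itv/= => xab.
exact: is_derive_continuous (df _ (iD _ _ Da Db _ xab)).
Qed.

Lemma is_derive0_constant (R : realType) (D : set R) (f : R -> R) :
  is_interval D -> (forall x, D x -> is_derive x 1 f 0) ->
  forall x y, D x -> D y -> f x = f y.
Proof.
move=> iD df; suff le_const x y : x <= y -> D x -> D y -> f x = f y.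
  by move=> x y Dx Dy; case: (leP x y) => [|/ltW] xy; [|symmetry];
    exact: le_const.
move=> xy Dx Dy.
have [c _] : exists2 c, c \in `[x, y]%R & f y - f x = 0 * (y - x).
  apply: (MVT_segment (df := fun=> 0)) xy _ _;
    last exact: within_continuous_itv df Dx Dy.
  by move=> t; rewrite in_itv/= => /andP[xt ty]; apply/df/(iD x y) => //;
    rewrite !ltW.
by rewrite mul0r => /eqP; rewrite subr_eq0 => /eqP.
Qed.

Lemma is_derive_neq0_inj (R : realType) (D : set R) (f f' : R -> R) :
  is_interval D -> (forall x, D x -> is_derive x 1 f (f' x)) ->
  (forall x, D x -> f' x != 0) ->
  forall x y, D x -> D y -> f x = f y -> x = y.
Proof.
move=> iD df f'0; suff no_lt x y : x < y -> D x -> D y -> f x <> f y.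
  move=> x y Dx Dy fxy; case: (ltgtP x y) => // xy.
    by case: (no_lt x y xy Dx Dy).
  by case: (no_lt y x xy Dy Dx).
move=> xy Dx Dy fxy.
have Dc c : c \in `]x, y[%R -> D c.
  by rewrite in_itv/= => /andP[xc cy]; apply: (iD x y) => //; rewrite !ltW.
have [|c cxy dc0] := Rolle xy _ (within_continuous_itv iD df Dx Dy) fxy.
  by move=> c /Dc/df[].
have /eqP[] := f'0 _ (Dc _ cxy).
by have [_ <-] := df _ (Dc _ cxy); have [_ <-] := dc0.
Qed.

Lemma near_ltgt (R : realType) (D : set R) (x : R) : open D -> D x ->
  exists a b, [/\ D a, D b, a < x, x < b & forall t, a <= t <= b -> D t].
Proof.
move=> oD Dx; have /nbhs_ballP[e /= e0 eD] := near_open oD Dx.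
have De t : x - e / 2 <= t <= x + e / 2 -> D t.
  by move=> /andP[h1 h2]; apply: eD; rewrite /ball/= ltr_norml; apply/andP;
    split; lra.
have e20 : 0 < e / 2 by rewrite divr_gt0.
exists (x - e / 2), (x + e / 2); split => //; try (apply: De); try lra.
Qed.

(** Injectivity comes from Rolle, then a continuous injective function is
    strictly monotone on a small segment around each point, so that its image
    contains a neighbourhood of the value. *)
Lemma open_interval_image (R : realType) (D : set R) (f f' : R -> R) :
  open D -> is_interval D -> (forall x, D x -> is_derive x 1 f (f' x)) ->
  (forall x, D x -> f' x != 0) -> open (f @` D) /\ is_interval (f @` D).
Proof.
move=> oD iD df f'0; split; last first.
  apply/connected_intervalP/connected_continuous_connected.
    exact/connected_intervalP.
  by apply: continuous_in_subspaceT => x; rewrite inE => /df/is_derive_continuous.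
have finj := is_derive_neq0_inj iD df f'0.
rewrite openE => _ [x Dx <-].
have [a [b [Da Db ax xb abD]]] := near_ltgt oD Dx.
have ab : a <= b by rewrite ltW// (lt_trans ax).
have fC := within_continuous_itv iD df Da Db.
have fI : {in `[a, b] &, injective f}.
  by move=> u v; rewrite !in_itv/= => /abD Du /abD Dv; exact: finj.
have fab := continuous_inj_image_segment ab fC fI.
suff fx : f x \in `](Num.min (f a) (f b)), (Num.max (f a) (f b))[%R.
  have := near_in_itvoo fx; apply: filterS => t tab.
  have : (f @`[a, b])%classic t by rewrite /= in_itv/=; move: tab;
    rewrite in_itv/= => /andP[h1 h2]; rewrite !ltW.
  by rewrite -fab => -[u]; rewrite /= in_itv/= => /abD Du <-; exists u.
have xab : x \in `[a, b] by rewrite in_itv/= !ltW.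
have aab : a \in `[a, b] by rewrite in_itv/= lexx.
have bab : b \in `[a, b] by rewrite in_itv/= lexx andbT.
rewrite in_itv/= gt_min lt_max; case: (itv_continuous_inj_mono fC fI).
  move=> mono; have fax : f a < f x by exact: mono.
  by have fxb : f x < f b by [exact: mono]; rewrite fax fxb orbT.
move=> mono; have fax : f x < f a by exact: mono.
by have fxb : f b < f x by [exact: mono]; rewrite fax fxb orbT.
Qed.

(** The nonvanishing derivative makes f injective by Rolle, so a set-theoretic
    inverse exists on the whole interval; differentiating it is then a local
    matter. *)
Lemma interval_inverse (R : realType) (D : set R) (f f' : R -> R) :
  open D -> is_interval D -> (forall x, D x -> is_derive x 1 f (f' x)) ->
  (forall x, D x -> f' x != 0) ->
  exists g : R -> R, forall x, D x ->
    g (f x) = x /\ is_derive (f x) 1 g (f' x)^-1.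
Proof.
move=> oD iD df f'0.
have finj := is_derive_neq0_inj iD df f'0.
pose g t := xget 0 [set x | D x /\ f x = t].
have gK x : D x -> g (f x) = x.
  move=> Dx; rewrite /g; case: xgetP => [y _ [Dy fy]|/(_ x)[]//].
  exact: finj.
exists g => x Dx; split; first exact: gK.
apply: is_derive_inverse; [| |exact: df|exact: f'0].
  by apply: filterS (near_open oD Dx) => t /gK.
by apply: filterS (near_open oD Dx) => t /df/is_derive_continuous.
Qed.

(** On an unbounded or open interval no endpoint can serve as base of the
    integral, whence the two one-sided integrals from an interior point; one of
    them is over an empty set. *)
Lemma antiderivative (R : realType) (D : set R) (f : R -> R) :
  open D -> is_interval D -> (forall x, D x -> {for x, continuous f}) ->
  exists s : R -> R, forall x, D x -> is_derive x 1 s (f x).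
Proof.
move=> oD iD fC.
have [[x0 Dx0]|noD] := pselect (D !=set0); last first.
  by exists f => x Dx; case: noD; exists x.
pose mu := @lebesgue_measure R.
pose s x := \int[mu]_(t in `]x0, x]) f t - \int[mu]_(t in `]x, x0]) f t.
exists s => x Dx.
(* A base point a to the left of both x0 and x turns s into a single integral
   up to a constant, to which the fundamental theorem applies. *)
have [a [Da ax0 ax]] : exists a, [/\ D a, a < x0 & a < x].
  have [|] := leP x0 x => xx0.
    by have [a [b [Da _ h _ _]]] := near_ltgt oD Dx0; exists a; split => //;
      exact: lt_le_trans h xx0.
  by have [a [b [Da _ h _ _]]] := near_ltgt oD Dx; exists a; split => //;
    exact: lt_trans h xx0.
have [b [Db xb]] : exists b, D b /\ x < b.
  by have [c [b [_ Db _ h _]]] := near_ltgt oD Dx; exists b.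
have fint u v : D u -> D v -> mu.-integrable `[u, v] (EFin \o f).
  move=> Du Dv; apply: continuous_compact_integrable;
    first exact: segment_compact.
  apply: continuous_subspace_itv => t; rewrite in_itv/= => tuv.
  exact: fC (iD _ _ Du Dv _ tuv).
have sE t : a < t -> D t ->
    s t = \int[mu]_(u in `[a, t]) f u - \int[mu]_(u in `[a, x0]) f u.
  move=> at_ Dt; rewrite /s; case: (leP x0 t) => tx0.
    rewrite [X in _ - X](_ : _ = 0) ?subr0; last first.
      by rewrite set_itv_ge ?Rintegral_set0// -leNgt bnd_simp.
    by rewrite Rintegral_itvB// ?bnd_simp ?(ltW ax0)//; exact: fint.
  rewrite [X in X - _](_ : _ = 0) ?sub0r; last first.
    by rewrite set_itv_ge ?Rintegral_set0// -leNgt bnd_simp ltW.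
  by rewrite -[RHS]opprB; congr (- _);
    rewrite Rintegral_itvB// ?bnd_simp ?(ltW at_) ?(ltW tx0)//; exact: fint.
have [dF vF] := continuous_FTC1_closed xb (fint _ _ Da Db) ax (fC _ Dx).
pose c := \int[mu]_(u in `[a, x0]) f u.
have sub_cst (F : R -> R) l :
    is_derive x 1 F l -> is_derive x 1 (fun t => F t - c) l.
  move=> dFl; have -> : (fun t => F t - c) = F - cst c by [].
  by rewrite -[l]subr0; exact: is_deriveB.
have dFx : is_derive x 1 (fun t => \int[mu]_(u in `[a, t]) f u - c) (f x).
  by apply: sub_cst; apply: DeriveDef => //; rewrite -derive1E.
have oDa : open (D `&` [set t | a < t]) by apply: openI => //; exact: open_gt.
by apply: (is_derive_eq_on oDa) dFx => // t [Dt at_]; rewrite sE.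
Qed.

(** * Polynomial expressions in the jet of a curve *)

(** Conversion between derivatives of different orders unfolds limits and does
    not terminate in practice, so derivatives stay folded and are turned into
    variables before ring normalization. *)
#[local] Arguments derive1n : simpl never.

Ltac jet_ring :=
  repeat match goal with
  | |- context [derive1n ?n ?y ?x] => generalize (derive1n n y x); intro
  end; ring.

(** Polynomial expressions are kept as syntax so that they can be
    differentiated formally any number of times, their highest variable can be
    read off, and they can be substituted into one another. *)
Inductive expr (R : Type) : Type :=
| Const of R
| Var of nat
| Add of expr R & expr R
| Mul of expr R & expr R.
Arguments Var {R}.

Fixpoint eval (R : realType) (z : nat -> R) (e : expr R) : R :=
  match e with
  | Const c => c
  | Var i => z i
  | Add e1 e2 => eval z e1 + eval z e2
  | Mul e1 e2 => eval z e1 * eval z e2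
  end.

(** The derivation of the polynomial ring that sends the variable i to dv i. *)
Fixpoint derivation (R : realType) (dv : nat -> expr R) (e : expr R) : expr R :=
  match e with
  | Const _ => Const 0
  | Var i => dv i
  | Add e1 e2 => Add (derivation dv e1) (derivation dv e2)
  | Mul e1 e2 => Add (Mul (derivation dv e1) e2) (Mul e1 (derivation dv e2))
  end.

Fixpoint subst (R : realType) (s : nat -> expr R) (e : expr R) : expr R :=
  match e with
  | Const c => Const c
  | Var i => s i
  | Add e1 e2 => Add (subst s e1) (subst s e2)
  | Mul e1 e2 => Mul (subst s e1) (subst s e2)
  end.

Fixpoint vars_below (R : Type) (n : nat) (e : expr R) : bool :=
  match e with
  | Const _ => true
  | Var i => (i < n)%N
  | Add e1 e2 | Mul e1 e2 => vars_below n e1 && vars_below n e2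
  end.

Lemma eval_subst (R : realType) (z : nat -> R) (s : nat -> expr R) (e : expr R) :
  eval z (subst s e) = eval (fun i => eval z (s i)) e.
Proof. by elim: e => //= e1 -> e2 ->. Qed.

Lemma eq_eval (R : realType) (n : nat) (z z' : nat -> R) (e : expr R) :
  vars_below n e -> (forall i, (i < n)%N -> z i = z' i) -> eval z e = eval z' e.
Proof.
move=> + zz'; elim: e => //= [e1 ih1 e2 ih2|e1 ih1 e2 ih2].
  by move=> /andP[/ih1-> /ih2->].
by move=> /andP[/ih1-> /ih2->].
Qed.

Lemma vars_belowW (R : Type) (m n : nat) (e : expr R) :
  (m <= n)%N -> vars_below m e -> vars_below n e.
Proof.
move=> mn; elim: e => //= [i|e1 ih1 e2 ih2|e1 ih1 e2 ih2].
- by move=> im; exact: leq_trans mn.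
- by move=> /andP[/ih1-> /ih2->].
- by move=> /andP[/ih1-> /ih2->].
Qed.

Lemma vars_below_derivation (R : realType) (m n : nat) (dv : nat -> expr R)
    (e : expr R) :
  (m <= n)%N -> (forall i, (i < m)%N -> vars_below n (dv i)) ->
  vars_below m e -> vars_below n (derivation dv e).
Proof.
move=> mn dvn; elim: e => //= [e1 ih1 e2 ih2|e1 ih1 e2 ih2].
  by move=> /andP[/ih1-> /ih2->].
move=> /andP[b1 b2]; rewrite ih1// ih2//.
by rewrite (vars_belowW mn b1) (vars_belowW mn b2).
Qed.

Lemma is_derive_eval (R : realType) (z : nat -> R -> R) (dv : nat -> expr R)
    (x : R) (e : expr R) :
  (forall i, is_derive x 1 (z i) (eval (z^~ x) (dv i))) ->
  is_derive x 1 (fun t => eval (z^~ t) e) (eval (z^~ x) (derivation dv e)).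
Proof.
move=> dz; elim: e => [c|i|e1 ih1 e2 ih2|e1 ih1 e2 ih2] /=.
- exact: is_derive_cst.
- exact: dz.
- exact: is_deriveD.
- by apply: is_derive_eq; rewrite addrC /GRing.scale/= mulrC [_ * eval _ e2]mulrC.
Qed.

(** Along a curve y, variable 0 is an auxiliary function w whose derivative is
    again polynomial in the variables, variable 1 is the abscissa and variable
    j + 2 is the j-th derivative of y. The function w serves to adjoin an
    inverse, such as that of a square root or of a slope. *)
Definition jet_var (R : realType) (w y : R -> R) (i : nat) (x : R) : R :=
  match i with
  | 0 => w x
  | 1 => x
  | j.+2 => derive1n j y x
  end.

Definition jet_dvar (R : realType) (dw : expr R) (i : nat) : expr R :=
  match i with
  | 0 => dw
  | 1 => Const 1
  | j.+2 => Var j.+3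
  end.

Notation jet_eval w y x := (eval (fun i => jet_var w y i x)).

Lemma is_derive_derive1n (R : realType) (D : set R) (y : R -> R) (x : R) n :
  smooth_curve D y -> D x ->
  is_derive x 1 (derive1n n y) (derive1n n.+1 y x).
Proof.
by move=> sy Dx; apply: DeriveDef; [exact: sy|rewrite derive1nS derive1E].
Qed.

(** The link between formal and actual derivatives: derivatives of all orders
    of a polynomial in the jet are polynomials in the jet as soon as w' is. *)
Lemma is_derive_jet_eval (R : realType) (D : set R) (w y : R -> R)
    (dw e : expr R) (x : R) :
  smooth_curve D y -> D x -> is_derive x 1 w (jet_eval w y x dw) ->
  is_derive x 1 (fun t => jet_eval w y t e)
    (jet_eval w y x (derivation (jet_dvar dw) e)).
Proof.
move=> sy Dx dwx; apply: is_derive_eval => -[|[|n]];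
  [exact: dwx|exact: is_derive_id|].
exact: (is_derive_derive1n n sy Dx).
Qed.

(** * The factor |S2|^(-1/2) *)

Definition inv_sqrt_S2 (R : realType) (y : R -> R) (x : R) : R :=
  (Num.sqrt `|S2 y x|)^-1.

Definition S2_expr (R : realType) : expr R :=
  Add (Mul (Const 3) (Mul (Var 4) (Var 6)))
      (Mul (Const (- 5)) (Mul (Var 5) (Var 5))).

(** The derivative of 3 y_xx y_xxxx - 5 y_xxx^2, after simplification. *)
Definition dS2_expr (R : realType) : expr R :=
  Add (Mul (Const 3) (Mul (Var 4) (Var 7)))
      (Mul (Const (- 7)) (Mul (Var 5) (Var 6))).

(** With w = |S2|^(-1/2), w' = - w^3 sigma S2' / 2 and sigma = S2 w^2. The
    resulting form - w^5 S2 S2' / 2 makes no case distinction on the sign of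
    S2. *)
Definition dinv_sqrt_S2_expr (R : realType) : expr R :=
  Mul (Const (- 2^-1))
    (Mul (Mul (Var 0) (Mul (Mul (Var 0) (Var 0)) (Mul (Var 0) (Var 0))))
         (Mul (S2_expr R) (dS2_expr R))).

Lemma jet_eval_S2 (R : realType) (w y : R -> R) (x : R) :
  jet_eval w y x (S2_expr R) = S2 y x.
Proof. by rewrite /S2 /=; jet_ring. Qed.

Lemma is_derive_S2 (R : realType) (D : set R) (w y : R -> R) (x : R) :
  smooth_curve D y -> D x ->
  is_derive x 1 (S2 y) (jet_eval w y x (dS2_expr R)).
Proof.
move=> sy Dx.
have -> : S2 y = fun t => jet_eval id y t (S2_expr R).
  by apply/funext => t; rewrite jet_eval_S2.
apply: (@is_derive_eq _ _ _ _ _ _ _ _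
  (is_derive_jet_eval (dw := Const 1) _ sy Dx _)).
  by rewrite /=; jet_ring.
Qed.

Lemma inv_sqrt_S2_gt0 (R : realType) (y : R -> R) (x : R) :
  S2 y x != 0 -> 0 < inv_sqrt_S2 y x.
Proof. by move=> S0; rewrite invr_gt0 sqrtr_gt0 normr_gt0. Qed.

Lemma inv_sqrt_S2_pow2 (R : realType) (y : R -> R) (x : R) :
  inv_sqrt_S2 y x ^+ 2 = `|S2 y x|^-1.
Proof. by rewrite /inv_sqrt_S2 exprVn sqr_sqrtr. Qed.

Lemma inv_sqrt_S2_pow4 (R : realType) (y : R -> R) (x : R) :
  S2 y x != 0 -> inv_sqrt_S2 y x ^+ 4 * S2 y x ^+ 2 = 1.
Proof.
move=> S0; rewrite (exprM _ 2 2) inv_sqrt_S2_pow2 exprVn real_normK ?num_real//.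
by rewrite mulVf// expf_neq0.
Qed.

Lemma signatureE (R : realType) (y : R -> R) (x : R) :
  S2 y x != 0 -> signature y x = S2 y x * inv_sqrt_S2 y x ^+ 2.
Proof.
move=> S0; rewrite inv_sqrt_S2_pow2 /signature {2}[S2 y x]numEsg mulfK//.
by rewrite normr_eq0.
Qed.

(** The absolute value is differentiated as the square root of a square. *)
Lemma is_derive_inv_sqrt_S2 (R : realType) (D : set R) (y : R -> R) (x : R) :
  smooth_curve D y -> D x -> S2 y x != 0 ->
  is_derive x 1 (inv_sqrt_S2 y) (jet_eval (inv_sqrt_S2 y) y x
    (dinv_sqrt_S2_expr R)).
Proof.
move=> sy Dx S0.
have dS := is_derive_S2 (inv_sqrt_S2 y) sy Dx.
set dS2 := jet_eval _ _ _ _ in dS.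
have S4 := inv_sqrt_S2_pow4 S0.
have w0 := inv_sqrt_S2_gt0 S0.
pose sq t := S2 y t ^+ 2; pose absS2 := Num.sqrt \o sq.
have wE : inv_sqrt_S2 y = fun t => (Num.sqrt (absS2 t))^-1.
  by apply/funext => t; rewrite /absS2/= sqrtr_sqr.
have S20 : 0 < sq x by rewrite lt0r sqrf_eq0 S0 sqr_ge0.
have sS20 : 0 < absS2 x by rewrite sqrtr_gt0.
have dsq : is_derive x 1 sq (2 * S2 y x * dS2).
  by apply: is_derive_eq; rewrite /GRing.scale/=; ring.
have d1 : is_derive x 1 absS2 ((2 * Num.sqrt (sq x))^-1 * (2 * S2 y x * dS2)).
  by apply: is_derive1_comp; exact: is_derive1_sqrt.
have d2 : is_derive x 1 (Num.sqrt \o absS2) ((2 * Num.sqrt (absS2 x))^-1 *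
    ((2 * Num.sqrt (sq x))^-1 * (2 * S2 y x * dS2))).
  by apply: is_derive1_comp; exact: is_derive1_sqrt.
have ss0 : (Num.sqrt \o absS2) x != 0 by rewrite gt_eqF// sqrtr_gt0.
have wV : Num.sqrt (absS2 x) = (inv_sqrt_S2 y x)^-1.
  by rewrite /absS2/= sqrtr_sqr /inv_sqrt_S2 invrK.
have wV2 : absS2 x = (inv_sqrt_S2 y x)^-2.
  by rewrite inv_sqrt_S2_pow2 invrK /absS2/= sqrtr_sqr.
rewrite wE; apply: (@is_derive_eq _ _ _ _ _ _ _ _ (@is_deriveV _ _ _ _ _ ss0 d2)).
rewrite -wE.
pose w := inv_sqrt_S2 y x.
rewrite -[jet_eval _ _ _ _]/(- 2^-1 * (w * (w * w * (w * w)) *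
  (jet_eval (inv_sqrt_S2 y) y x (S2_expr R) * dS2))) /w.
rewrite jet_eval_S2 /= wV -[Num.sqrt (sq x)]/(absS2 x) wV2 /GRing.scale/=.
by field; rewrite gt_eqF.
Qed.

(** * The affine moving frame and its Frenet equations *)

Ltac jet_field :=
  repeat match goal with
  | |- context [derive1n ?n ?y ?x] => generalize (derive1n n y x); intro
  end;
  repeat match goal with
  | |- context [inv_sqrt_S2 ?y ?x] => generalize (inv_sqrt_S2 y x); intro
  end;
  repeat match goal with
  | |- context [Num.sqrt ?a] => generalize (Num.sqrt a); intro
  end; intros; field.

(** This is dx/ds, the reciprocal of the arc element. *)
Definition speed (R : realType) (y : R -> R) (x : R) : R :=
  Num.sqrt 3 * derive1n 2 y x * inv_sqrt_S2 y x.

(** The pair (normal_x, normal_y) is a multiple of the affine normal (- y_xxx,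
    3 y_xx^2 - y_x y_xxx). The factor y_xx / |S2| is the one for which affine
    maps of positive determinant act on it linearly. *)
Definition normal_x (R : realType) (y : R -> R) (x : R) : R :=
  - (derive1n 2 y x * inv_sqrt_S2 y x ^+ 2 * derive1n 3 y x).

Definition normal_y (R : realType) (y : R -> R) (x : R) : R :=
  derive1n 2 y x * inv_sqrt_S2 y x ^+ 2 *
  (3 * derive1n 2 y x ^+ 2 - derive1n 1 y x * derive1n 3 y x).

Definition tangent_y (R : realType) (y : R -> R) (x : R) : R :=
  speed y x * derive1n 1 y x.

Lemma sqrt3_sq (R : realType) : Num.sqrt 3 ^+ 2 = 3 :> R.
Proof. by rewrite sqr_sqrtr. Qed.

Lemma sqrt3_neq0 (R : realType) : Num.sqrt 3 != 0 :> R.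
Proof. by rewrite gt_eqF// sqrtr_gt0. Qed.

Lemma curvatureE (R : realType) (y : R -> R) (x : R) :
  curvature y x = Num.sqrt 3 / 3 * inv_sqrt_S2 y x ^+ 3 *
    (9 * derive1n 2 y x ^+ 2 * derive1n 5 y x
     - 45 * derive1n 2 y x * derive1n 3 y x * derive1n 4 y x
     + 40 * derive1n 3 y x ^+ 3).
Proof.
rewrite /curvature /inv_sqrt_S2 invfM -exprVn; move: (Num.sqrt `|S2 y x|) => T.
by move: T^-1 => w; jet_field.
Qed.

Lemma ddsE (R : realType) (y h : R -> R) (x : R) :
  dds y h x = speed y x * derive1 h x.
Proof. by []. Qed.

Lemma speed_neq0 (R : realType) (D : set R) (y : R -> R) (x : R) :
  regular D y -> D x -> speed y x != 0.
Proof.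
move=> [_ _ reg] Dx; have [h1 h2] := reg _ Dx.
by rewrite /speed !mulf_neq0 ?sqrt3_neq0// gt_eqF// inv_sqrt_S2_gt0.
Qed.

Lemma arc_elementE (R : realType) (y : R -> R) (x : R) :
  arc_element y x = (speed y x)^-1.
Proof. by rewrite /arc_element /speed /inv_sqrt_S2 [RHS]invfM invrK mulrC. Qed.

(** The first-order system satisfied by the two abscissas, and also by the two
    ordinates, of the frame vectors. The division by the speed converts from
    derivatives in s to derivatives in x. *)
Definition frenet (R : realType) (y f1 f2 : R -> R) (x : R) : Prop :=
  is_derive x 1 f1
    ((- (signature y x * curvature y x / 2) * f1 x + f2 x) / speed y x) /\
  is_derive x 1 f2
    ((- (signature y x / 3) * f1 x - signature y x * curvature y x * f2 x)
     / speed y x).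

Definition speed_expr (R : realType) : expr R :=
  Mul (Mul (Const (Num.sqrt 3)) (Var 4)) (Var 0).
Definition normal_x_expr (R : realType) : expr R :=
  Mul (Const (-1)) (Mul (Mul (Var 4) (Mul (Var 0) (Var 0))) (Var 5)).
Definition normal_y_expr (R : realType) : expr R :=
  Mul (Mul (Var 4) (Mul (Var 0) (Var 0)))
    (Add (Mul (Const 3) (Mul (Var 4) (Var 4)))
         (Mul (Const (-1)) (Mul (Var 3) (Var 5)))).

(** Direct computation; the two sides agree modulo the relations w^4 S2^2 = 1
    for w = |S2|^(-1/2), and 3 = (sqrt 3)^2. *)
Lemma frenet_equations (R : realType) (D : set R) (y : R -> R) (x : R) :
  regular D y -> D x ->
  frenet y (speed y) (normal_x y) x /\ frenet y (tangent_y y) (normal_y y) x.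
Proof.
move=> reg Dx; have l0 := speed_neq0 reg Dx.
have [_ sy /(_ _ Dx)[y20 S0]] := reg.
have dw := is_derive_inv_sqrt_S2 sy Dx S0.
have key (f : R -> R) (v : R) (e : expr R) :
    (forall t, f t = jet_eval (inv_sqrt_S2 y) y t e) ->
    speed y x * jet_eval (inv_sqrt_S2 y) y x
      (derivation (jet_dvar (dinv_sqrt_S2_expr R)) e) = v ->
    is_derive x 1 f (v / speed y x).
  move=> fe <-; rewrite mulrC mulKf//.
  have -> : f = fun t => jet_eval (inv_sqrt_S2 y) y t e by exact/funext.
  exact: (is_derive_jet_eval _ sy Dx dw).
have K : signature y x * curvature y x =
    S2 y x * inv_sqrt_S2 y x ^+ 5 * Num.sqrt 3 / 3 *
    (9 * derive1n 2 y x ^+ 2 * derive1n 5 y x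
     - 45 * derive1n 2 y x * derive1n 3 y x * derive1n 4 y x
     + 40 * derive1n 3 y x ^+ 3).
  by rewrite signatureE// curvatureE; move: (S2 y x) => S; jet_field.
have S4 := inv_sqrt_S2_pow4 S0.
have q3 := sqrt3_sq R.
(* To prove l = r it suffices to exhibit the cofactors c and c' of the two
   relations. *)
have mod_rel (l r c c' : R) :
    l = r + c * (1 - inv_sqrt_S2 y x ^+ 4 * S2 y x ^+ 2)
          + c' * (3 - Num.sqrt 3 ^+ 2) ->
    l = r.
  by rewrite S4 q3 !subrr !mulr0 !addr0.
pose N := 9 * derive1n 2 y x ^+ 2 * derive1n 5 y x
     - 45 * derive1n 2 y x * derive1n 3 y x * derive1n 4 y x
     + 40 * derive1n 3 y x ^+ 3.
(* X is the coefficient of (sqrt 3)^2 in the difference of the two sides of the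
   first equation. *)
pose X := derive1n 2 y x * inv_sqrt_S2 y x ^+ 2 * derive1n 3 y x
   - derive1n 2 y x ^+ 2 * inv_sqrt_S2 y x ^+ 6 * S2 y x
     * (3 * derive1n 2 y x * derive1n 5 y x
        - 7 * derive1n 3 y x * derive1n 4 y x) / 2
   + S2 y x * inv_sqrt_S2 y x ^+ 6 * N * derive1n 2 y x / 6.
rewrite /frenet !K signatureE//; split; split.
- apply: (key _ _ (speed_expr R)); first by move=> t; rewrite /= /speed.
  apply: (mod_rel _ _
    (4 * derive1n 3 y x * derive1n 2 y x * inv_sqrt_S2 y x ^+ 2) (- X)).
  by rewrite [LHS]/= /X /N /normal_x /speed /S2; jet_field.
- apply: (key _ _ (normal_x_expr R)); first by move=> t; rewrite /= /normal_x;
    jet_ring.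
  apply: (mod_rel _ _ (- (8 / 3) * derive1n 3 y x ^+ 2 * inv_sqrt_S2 y x ^+ 3
    * Num.sqrt 3 * derive1n 2 y x) 0).
  by rewrite [LHS]/= /normal_x /speed /S2; jet_field.
- apply: (key _ _ (Mul (speed_expr R) (Var 3))); first by move=> t;
    rewrite /= /tangent_y /speed.
  apply: (mod_rel _ _
    (4 * derive1n 3 y x * derive1n 2 y x * inv_sqrt_S2 y x ^+ 2 * derive1n 1 y x)
    (- (X * derive1n 1 y x + derive1n 2 y x ^+ 3 * inv_sqrt_S2 y x ^+ 2))).
  by rewrite [LHS]/= /X /N /tangent_y /normal_y /speed /S2; jet_field.
- apply: (key _ _ (normal_y_expr R)); first by move=> t; rewrite /= /normal_y;
    jet_ring.
  apply: (mod_rel _ _ ((- (8 / 3) * derive1n 3 y x ^+ 2 * derive1n 1 y x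
    + 8 * derive1n 2 y x ^+ 2 * derive1n 3 y x)
    * inv_sqrt_S2 y x ^+ 3 * Num.sqrt 3 * derive1n 2 y x) 0).
  by rewrite [LHS]/= /tangent_y /normal_y /speed /S2; jet_field.
Qed.

(** * Effect of an affine map on jets, frame and curvature *)

(** The reciprocal of the derivative of the image abscissa a x + b y + e. *)
Definition inv_slope (R : realType) (a b : R) (y : R -> R) (x : R) : R :=
  (a + b * derive1n 1 y x)^-1.

Definition dinv_slope_expr (R : realType) (b : R) : expr R :=
  Mul (Const (- b)) (Mul (Var 4) (Mul (Var 0) (Var 0))).

Definition maps_curve (R : realType) (a b c d e f : R) (D1 : set R)
    (y1 : R -> R) (D2 : set R) (y2 : R -> R) : Prop :=
  forall x, D1 x -> D2 (a * x + b * y1 x + e) /\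
    y2 (a * x + b * y1 x + e) = c * x + d * y1 x + f.

Lemma is_derive_affine_comb (R : realType) (a b e : R) (D : set R)
    (y : R -> R) (x : R) :
  smooth_curve D y -> D x ->
  is_derive x 1 (fun t => a * t + b * y t + e) (a + b * derive1n 1 y x).
Proof.
move=> sy Dx; have dy := is_derive_derive1n 0 sy Dx; rewrite derive1n0 in dy.
by apply: is_derive_eq; rewrite /GRing.scale/=; jet_ring.
Qed.

Lemma is_derive_inv_slope (R : realType) (a b : R) (D : set R)
    (y : R -> R) (x : R) :
  smooth_curve D y -> D x -> a + b * derive1n 1 y x != 0 ->
  is_derive x 1 (inv_slope a b y)
    (jet_eval (inv_slope a b y) y x (dinv_slope_expr b)).
Proof.
move=> sy Dx q0; have dy := is_derive_derive1n 1 sy Dx.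
have dq : is_derive x 1 (fun t => a + b * derive1n 1 y t) (b * derive1n 2 y x).
  by apply: is_derive_eq; rewrite /GRing.scale/=; jet_ring.
have dV : is_derive x 1 (inv_slope a b y) _ :=
  @is_deriveV R (fun t => a + b * derive1n 1 y t) x _ 1 q0 dq.
apply: (@is_derive_eq _ _ _ _ _ _ _ _ dV).
by rewrite /= /inv_slope /GRing.scale/= -exprVn; jet_ring.
Qed.

(** The image of a tangent vector is tangent to the second graph, hence cannot
    be vertical; if its abscissa vanished, so would its ordinate, and the
    linear part would be singular. *)
Lemma maps_curve_slope_neq0 (R : realType) (a b c d e f : R) (D1 : set R)
    (y1 : R -> R) (D2 : set R) (y2 : R -> R) (x : R) :
  open D1 -> smooth_curve D1 y1 -> smooth_curve D2 y2 -> a * d - b * c != 0 ->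
  maps_curve a b c d e f D1 y1 D2 y2 -> D1 x -> a + b * derive1n 1 y1 x != 0.
Proof.
move=> oD1 sy1 sy2 det0 m Dx; have [D2x _] := m _ Dx.
apply: contra_neq det0 => q0.
have d1 := is_derive_affine_comb a b e sy1 Dx.
have d2 := is_derive_affine_comb c d f sy1 Dx.
have d3 := @is_derive1_comp R (derive1n 0 y2) (fun t => a * t + b * y1 t + e) x
  _ _ (is_derive_derive1n 0 sy2 D2x) d1.
have d4 : is_derive x 1 (fun t => c * t + d * y1 t + f) _ :=
  is_derive_eq_on oD1 (fun t Dt => (m t Dt).2) Dx d3.
have : c + d * derive1n 1 y1 x = 0.
  by have [_ <-] := d2; have [_ ->] := d4; rewrite q0 mulr0.
have [->|d0] := eqVneq d 0; first by rewrite mul0r addr0 => ->;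
  rewrite !mulr0 subr0.
move=> /eqP; rewrite addrC addr_eq0 => /eqP p.
apply: (mulIf d0); rewrite mul0r.
have -> : (a * d - b * c) * d = (a * d + b * - c) * d by ring.
by rewrite -p mulrCA mulrC [a * d]mulrC -mulrDr q0 !mulr0.
Qed.

(** Differentiating the identity for the n-th derivative of the image curve by
    the chain rule gives the next one: this is the prolongation of the affine
    map to jets. *)
Lemma jet_step (R : realType) (a b e : R) (D1 : set R) (y1 y2 : R -> R)
    (n : nat) (E : expr R) (x : R) :
  open D1 -> smooth_curve D1 y1 -> a + b * derive1n 1 y1 x != 0 ->
  (forall t, D1 t -> derive1n n y2 (a * t + b * y1 t + e) =
                     jet_eval (inv_slope a b y1) y1 t E) ->
  D1 x -> derivable (derive1n n y2) (a * x + b * y1 x + e) 1 ->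
  derive1n n.+1 y2 (a * x + b * y1 x + e) =
  jet_eval (inv_slope a b y1) y1 x
    (Mul (Var 0) (derivation (jet_dvar (dinv_slope_expr b)) E)).
Proof.
move=> oD1 sy1 q0 yE Dx /derivableP; rewrite -derive1E -derive1nS => d1.
have d2 := @is_derive1_comp R (derive1n n y2) (fun t => a * t + b * y1 t + e) x
  _ _ d1 (is_derive_affine_comb a b e sy1 Dx).
rewrite -[RHS]/(inv_slope a b y1 x * jet_eval (inv_slope a b y1) y1 x
  (derivation (jet_dvar (dinv_slope_expr b)) E)).
have [_ <-] := is_derive_jet_eval E sy1 Dx (is_derive_inv_slope sy1 Dx q0).
have [_ ->] := is_derive_eq_on oD1 yE Dx d2.
by rewrite /inv_slope [RHS]mulrC mulfK.
Qed.

Lemma image_jet (R : realType) (a b c d e f : R) (D1 : set R)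
    (y1 : R -> R) (D2 : set R) (y2 : R -> R) (x : R) :
  open D1 -> smooth_curve D1 y1 -> smooth_curve D2 y2 -> a * d - b * c != 0 ->
  maps_curve a b c d e f D1 y1 D2 y2 -> D1 x ->
  let w := inv_slope a b y1 x in
  let z n := derive1n n y2 (a * x + b * y1 x + e) in
  let det := a * d - b * c in
  [/\ z 1%N = (c + d * derive1n 1 y1 x) * w,
      z 2%N = det * derive1n 2 y1 x * w ^+ 3,
      z 3%N = det * (derive1n 3 y1 x * w ^+ 4
               - 3 * b * derive1n 2 y1 x ^+ 2 * w ^+ 5) &
      z 4%N = det * (derive1n 4 y1 x * w ^+ 5
               - 10 * b * derive1n 2 y1 x * derive1n 3 y1 x * w ^+ 6
               + 15 * b ^+ 2 * derive1n 2 y1 x ^+ 3 * w ^+ 7)].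
Proof.
move=> oD1 sy1 sy2 det0 m Dx.
have q0 t : D1 t -> a + b * derive1n 1 y1 t != 0.
  exact: maps_curve_slope_neq0 oD1 sy1 sy2 det0 m.
have step n E t : (forall t, D1 t -> derive1n n y2 (a * t + b * y1 t + e) =
                     jet_eval (inv_slope a b y1) y1 t E) -> D1 t ->
  derive1n n.+1 y2 (a * t + b * y1 t + e) =
  jet_eval (inv_slope a b y1) y1 t
    (Mul (Var 0) (derivation (jet_dvar (dinv_slope_expr b)) E)).
  move=> yE Dt; have dy2 := sy2 n _ (m _ Dt).1.
  exact: jet_step oD1 sy1 (q0 _ Dt) yE Dt dy2.
pose E0 := Add (Add (Mul (Const c) (Var 1)) (Mul (Const d) (Var 2))) (Const f).
have z0 t : D1 t -> derive1n 0 y2 (a * t + b * y1 t + e) =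
                    jet_eval (inv_slope a b y1) y1 t E0.
  by move=> /m[].
have z1 t : D1 t -> derive1n 1 y2 (a * t + b * y1 t + e) =
    jet_eval (inv_slope a b y1) y1 t
      (Mul (Add (Const c) (Mul (Const d) (Var 3))) (Var 0)).
  by move=> Dt; rewrite (step _ _ _ z0 Dt) /=;
    move: (inv_slope a b y1 t) => w; jet_ring.
pose det := a * d - b * c.
have z2 t : D1 t -> derive1n 2 y2 (a * t + b * y1 t + e) =
    jet_eval (inv_slope a b y1) y1 t
      (Mul (Mul (Const det) (Var 4)) (Mul (Var 0) (Mul (Var 0) (Var 0)))).
  move=> Dt; rewrite (step _ _ _ z1 Dt) /= /inv_slope; move: (q0 _ Dt).
  by rewrite /det; jet_field.
have z3 t : D1 t -> derive1n 3 y2 (a * t + b * y1 t + e) =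
    jet_eval (inv_slope a b y1) y1 t
      (Mul (Const det) (Add
        (Mul (Var 5) (Mul (Mul (Var 0) (Var 0)) (Mul (Var 0) (Var 0))))
        (Mul (Mul (Const (- (3 * b))) (Mul (Var 4) (Var 4)))
          (Mul (Var 0) (Mul (Mul (Var 0) (Var 0)) (Mul (Var 0) (Var 0))))))).
  move=> Dt; rewrite (step _ _ _ z2 Dt) /=.
  by move: (inv_slope a b y1 t) => w; jet_ring.
rewrite /= (z1 _ Dx) (z2 _ Dx) (z3 _ Dx) (step _ _ _ z3 Dx).
by split; rewrite /= /det; move: (inv_slope a b y1 x) => w; jet_ring.
Qed.

(** Substitution of the transformed 4-jet. With w the inverse slope, |S2|^(1/2)
    is multiplied by |det| w^4, and positivity of the determinant removes the
    absolute value. *)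
Lemma image_frame (R : realType) (a b c d e f : R) (D1 : set R)
    (y1 : R -> R) (D2 : set R) (y2 : R -> R) (x : R) :
  open D1 -> smooth_curve D1 y1 -> smooth_curve D2 y2 -> 0 < a * d - b * c ->
  maps_curve a b c d e f D1 y1 D2 y2 -> D1 x -> S2 y1 x != 0 ->
  let x2 := a * x + b * y1 x + e in
  [/\ S2 y2 x2 = ((a * d - b * c) * inv_slope a b y1 x ^+ 4) ^+ 2 * S2 y1 x,
      speed y2 x2 = a * speed y1 x + b * tangent_y y1 x,
      tangent_y y2 x2 = c * speed y1 x + d * tangent_y y1 x,
      normal_x y2 x2 = a * normal_x y1 x + b * normal_y y1 x &
      normal_y y2 x2 = c * normal_x y1 x + d * normal_y y1 x].
Proof.
move=> oD1 sy1 sy2 det_gt0 m Dx S0 x2.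
have det0 : a * d - b * c != 0 by rewrite gt_eqF.
have q0 := maps_curve_slope_neq0 oD1 sy1 sy2 det0 m Dx.
have [] := image_jet oD1 sy1 sy2 det0 m Dx.
rewrite -/x2; set w := inv_slope a b y1 x => z1 z2 z3 z4.
have SE : S2 y2 x2 = ((a * d - b * c) * w ^+ 4) ^+ 2 * S2 y1 x.
  by rewrite /S2 z2 z3 z4; jet_ring.
have w0 : w != 0 by rewrite invr_eq0.
have iE : inv_sqrt_S2 y2 x2 = inv_sqrt_S2 y1 x / ((a * d - b * c) * w ^+ 4).
  move: SE; have : 0 < (a * d - b * c) * w ^+ 4.
    by rewrite mulr_gt0// (exprM _ 2 2) exprn_even_gt0//= expf_neq0.
  move: ((a * d - b * c) * w ^+ 4) => k k0 SE; rewrite /inv_sqrt_S2 SE normrM.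
  rewrite (ger0_norm (sqr_ge0 k)) sqrtrM ?sqr_ge0// sqrtr_sqr (gtr0_norm k0).
  by rewrite invfM mulrC.
have wE : w = (a + b * derive1n 1 y1 x)^-1 by [].
split=> //; rewrite /speed /tangent_y /normal_x /normal_y /speed ?z1 z2 ?z3 iE
  wE; clear - q0 det0; move: q0 det0; jet_field; by rewrite q0.
Qed.

Lemma image_signature (R : realType) (a b c d e f : R) (D1 : set R)
    (y1 : R -> R) (D2 : set R) (y2 : R -> R) (x : R) :
  open D1 -> smooth_curve D1 y1 -> smooth_curve D2 y2 -> 0 < a * d - b * c ->
  maps_curve a b c d e f D1 y1 D2 y2 -> D1 x -> S2 y1 x != 0 ->
  signature y2 (a * x + b * y1 x + e) = signature y1 x.
Proof.
move=> oD1 sy1 sy2 det_gt0 m Dx S0.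
have [SE _ _ _ _] := image_frame oD1 sy1 sy2 det_gt0 m Dx S0.
have q0 := maps_curve_slope_neq0 oD1 sy1 sy2 (lt0r_neq0 det_gt0) m Dx.
rewrite /signature SE sgrM gtr0_sg ?mul1r// exprn_even_gt0//=.
by rewrite mulf_neq0 ?(lt0r_neq0 det_gt0)// expf_neq0// invr_eq0.
Qed.

Lemma image_speed (R : realType) (a b c d e f : R) (D1 : set R)
    (y1 : R -> R) (D2 : set R) (y2 : R -> R) (x : R) :
  open D1 -> smooth_curve D1 y1 -> smooth_curve D2 y2 -> 0 < a * d - b * c ->
  maps_curve a b c d e f D1 y1 D2 y2 -> D1 x -> S2 y1 x != 0 ->
  speed y2 (a * x + b * y1 x + e) = speed y1 x * (a + b * derive1n 1 y1 x).
Proof.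
move=> oD1 sy1 sy2 det_gt0 m Dx S0.
have [_ -> _ _ _] := image_frame oD1 sy1 sy2 det_gt0 m Dx S0.
by rewrite /tangent_y mulrDr mulrC; congr (_ + _); rewrite mulrCA.
Qed.

(** The first Frenet equation of the image, pulled back, and the matching
    combination of the Frenet equations of the original curve describe the
    derivative of one and the same function; all their terms agree except for
    the coefficients sigma k, which must therefore agree as well. *)
Lemma image_curvature (R : realType) (a b c d e f : R) (D1 : set R)
    (y1 : R -> R) (D2 : set R) (y2 : R -> R) (x : R) :
  regular D1 y1 -> regular D2 y2 -> 0 < a * d - b * c ->
  maps_curve a b c d e f D1 y1 D2 y2 -> D1 x ->
  curvature y2 (a * x + b * y1 x + e) = curvature y1 x.
Proof.
move=> reg1 reg2 det_gt0 m Dx.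
have [[oD1 _ _] sy1 nd1] := reg1; have [_ sy2 _] := reg2.
have S0 t : D1 t -> S2 y1 t != 0 by move=> /nd1[].
have [D2x _] := m _ Dx.
have frame t (Dt : D1 t) := image_frame oD1 sy1 sy2 det_gt0 m Dt (S0 _ Dt).
have [_ sx _ nx _] := frame _ Dx.
have sgE := image_signature oD1 sy1 sy2 det_gt0 m Dx (S0 _ Dx).
have spE := image_speed oD1 sy1 sy2 det_gt0 m Dx (S0 _ Dx).
have q0 := maps_curve_slope_neq0 oD1 sy1 sy2 (lt0r_neq0 det_gt0) m Dx.
have sp20 := speed_neq0 reg2 D2x.
have [[dt1 _] [dt1' _]] := frenet_equations reg1 Dx.
have [[dt2 _] _] := frenet_equations reg2 D2x.
have dl := @is_derive1_comp R (speed y2) (fun t => a * t + b * y1 t + e) x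
  _ _ dt2 (is_derive_affine_comb a b e sy1 Dx).
have speedE t : D1 t ->
    speed y2 (a * t + b * y1 t + e) = a * speed y1 t + b * tangent_y y1 t.
  by move=> /frame[].
have [_] := is_derive_eq_on oD1 speedE Dx dl.
have dr : is_derive x 1 (fun t => a * speed y1 t + b * tangent_y y1 t) _ :=
  is_deriveD (is_deriveZ a dt1) (is_deriveZ b dt1').
have [_ ->] := dr.
rewrite /GRing.scale/= nx sgE.
have -> : forall A B C : R,
  a * ((- A * speed y1 x + B) / speed y1 x) +
  b * ((- A * tangent_y y1 x + C) / speed y1 x) =
  (- A * speed y2 (a * x + b * y1 x + e) + (a * B + b * C)) / speed y1 x.
  by move=> A B C; rewrite sx; ring.
have sp10 := speed_neq0 reg1 Dx.
have -> : forall A : R,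
  A / speed y2 (a * x + b * y1 x + e) * (a + b * derive1n 1 y1 x) =
  A / speed y1 x.
  move=> A; rewrite spE; move: (speed y1 x) (a + b * _) sp10 q0 => s q s0 q0.
  by field; rewrite s0.
move=> /(mulIf (invr_neq0 sp10)) /addIr /(mulIf sp20) /oppr_inj.
have two0 : (2 : R)^-1 != 0 by rewrite invr_eq0 pnatr_eq0.
have sg0 : signature y1 x != 0 by rewrite /signature sgr_eq0 S0.
move: (signature y1 x) (curvature y2 _) (curvature y1 x) sg0 => sg k2 k1 sg0.
by move=> /(mulIf two0) /(mulfI sg0).
Qed.

Lemma image_dds (R : realType) (a b c d e f : R) (D1 : set R)
    (y1 : R -> R) (D2 : set R) (y2 : R -> R) (h1 h2 : R -> R) (x : R) :
  open D1 -> smooth_curve D1 y1 -> smooth_curve D2 y2 -> 0 < a * d - b * c ->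
  maps_curve a b c d e f D1 y1 D2 y2 -> D1 x -> S2 y1 x != 0 ->
  (forall t, D1 t -> h2 (a * t + b * y1 t + e) = h1 t) ->
  derivable h2 (a * x + b * y1 x + e) 1 ->
  dds y2 h2 (a * x + b * y1 x + e) = dds y1 h1 x.
Proof.
move=> oD1 sy1 sy2 det_gt0 m Dx S0 hE /derivableP; rewrite -derive1E => dh2.
rewrite !ddsE (image_speed oD1 sy1 sy2 det_gt0 m Dx S0).
have dh := @is_derive1_comp R h2 (fun t => a * t + b * y1 t + e) x
  _ _ dh2 (is_derive_affine_comb a b e sy1 Dx).
have [_] := is_derive_eq_on oD1 hE Dx dh.
rewrite [derive1 h1 x]derive1E => ->.
by rewrite -mulrA; congr (_ * _); rewrite mulrC.
Qed.

(** The image is the graph of psi o phi^-1, where phi and psi are the image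
    coordinates. Its n-th derivative composed with phi is a polynomial in the
    jet of y and in 1 / phi', hence differentiable, and this carries the
    induction on n. *)
Lemma image_curve (R : realType) (a b c d e f : R) (D : set R) (y : R -> R) :
  open D -> is_interval D -> smooth_curve D y ->
  (forall x, D x -> a + b * derive1n 1 y x != 0) ->
  exists (D2 : set R) (y2 : R -> R),
    [/\ open D2, is_interval D2, smooth_curve D2 y2,
        maps_curve a b c d e f D y D2 y2 &
        forall x2, D2 x2 -> exists2 x, D x & x2 = a * x + b * y x + e].
Proof.
move=> oD iD sy q0; pose phi x := a * x + b * y x + e.
have dphi x : D x -> is_derive x 1 phi (a + b * derive1n 1 y x).
  exact: is_derive_affine_comb.
have [oD2 iD2] := open_interval_image oD iD dphi q0.
have [g gK] := interval_inverse oD iD dphi q0.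
pose y2 x2 := c * g x2 + d * y (g x2) + f.
have y2E x : D x -> y2 (phi x) = c * x + d * y x + f.
  by move=> /gK[gx _]; rewrite /y2 gx.
have der n E x : (forall t, D t ->
    derive1n n y2 (phi t) = jet_eval (inv_slope a b y) y t E) ->
    D x -> derivable (derive1n n y2) (phi x) 1.
  move=> yE Dx; have [gx dg] := gK _ Dx.
  have dE := is_derive_jet_eval E sy Dx (is_derive_inv_slope sy Dx (q0 _ Dx)).
  rewrite -{1}gx in dE; have dEg := is_derive1_comp dE dg.
  have D2x : (phi @` D) (phi x) by exists x.
  suff /(is_derive_eq_on oD2)/(_ D2x dEg)[] : forall x2, (phi @` D) x2 ->
      ((fun t => jet_eval (inv_slope a b y) y t E) \o g) x2 = derive1n n y2 x2.
    by [].
  by move=> _ [t Dt <-]; rewrite /= (gK _ Dt).1 yE.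
have jetE n : exists E, forall x, D x ->
    derive1n n y2 (phi x) = jet_eval (inv_slope a b y) y x E.
  elim: n => [|n [E yE]].
    exists (Add (Add (Mul (Const c) (Var 1)) (Mul (Const d) (Var 2))) (Const f)).
    by move=> x Dx; rewrite derive1n0 y2E.
  exists (Mul (Var 0) (derivation (jet_dvar (dinv_slope_expr b)) E)) => x Dx.
  exact: (jet_step oD sy (q0 _ Dx) yE Dx (der _ _ _ yE Dx)).
exists (phi @` D), y2; split => //.
- by move=> n _ [x Dx <-]; have [E yE] := jetE n; exact: der yE Dx.
- by move=> x Dx; split; [exists x|exact: y2E].
- by move=> _ [x Dx <-]; exists x.
Qed.

(** * The curvature derivatives as triangular coordinates on jets *)

(** The coefficient of the highest derivative y^(5+j) in d^j k / ds^j. *)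
Fixpoint lead_coeff_expr (R : realType) (j : nat) : expr R :=
  match j with
  | 0 => Mul (Const (3 * Num.sqrt 3))
           (Mul (Mul (Var 0) (Mul (Var 0) (Var 0))) (Mul (Var 4) (Var 4)))
  | j.+1 => Mul (speed_expr R) (lead_coeff_expr R j)
  end.

(** The terms of d^j k / ds^j that only involve derivatives of y up to the
    order 4 + j. *)
Fixpoint lower_expr (R : realType) (j : nat) : expr R :=
  match j with
  | 0 => Mul (Const (Num.sqrt 3 / 3))
           (Mul (Mul (Var 0) (Mul (Var 0) (Var 0)))
              (Add (Mul (Const (- 45)) (Mul (Var 4) (Mul (Var 5) (Var 6))))
                   (Mul (Const 40) (Mul (Var 5) (Mul (Var 5) (Var 5))))))
  | j.+1 =>
      let D := derivation (jet_dvar (dinv_sqrt_S2_expr R)) in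
      Mul (speed_expr R)
        (Add (Mul (D (lead_coeff_expr R j)) (Var (7 + j))) (D (lower_expr R j)))
  end.

Definition curvature_expr (R : realType) (j : nat) : expr R :=
  Add (Mul (lead_coeff_expr R j) (Var (7 + j))) (lower_expr R j).

Lemma vars_below_jet_derivation (R : realType) (n : nat) (e : expr R) :
  (7 <= n)%N -> vars_below n e ->
  vars_below n.+1 (derivation (jet_dvar (dinv_sqrt_S2_expr R)) e).
Proof.
move=> n7; apply: vars_below_derivation => // -[|[|j]] //= jn.
have lt_n m : (m < 8)%N -> (m < n.+1)%N by move=> m8; exact: leq_trans m8 _.
by rewrite !lt_n.
Qed.

Lemma vars_below_lead_coeff (R : realType) (j : nat) :
  vars_below 5 (lead_coeff_expr R j).
Proof. by elim: j. Qed.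

(** This triangularity is what allows solving for the derivatives of y in terms
    of those of k. *)
Lemma vars_below_lower (R : realType) (j : nat) :
  vars_below (7 + j) (lower_expr R j).
Proof.
elim: j => //= j ih; rewrite addnS ltnS leqnn (vars_below_jet_derivation _ ih)//.
have := vars_belowW (leq_addr j 7) (vars_belowW (isT : 5 <= 7)%N
  (vars_below_lead_coeff R j)).
by move=> /vars_below_jet_derivation ->.
Qed.

(** Differentiating lead * y^(5+j) + low along the curve gives lead * y^(6+j)
    plus terms of order at most 5 + j, since lead only involves w and y_xx, and
    w' only derivatives up to y^(5). *)
Lemma curvature_exprE (R : realType) (D : set R) (y : R -> R) (j : nat) (x : R) :
  regular D y -> D x ->
  iter j (dds y) (curvature y) x =
  jet_eval (inv_sqrt_S2 y) y x (curvature_expr R j).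
Proof.
move=> [[oD _ _] sy nd]; elim: j x => [|j ih] x Dx.
  by rewrite [LHS]curvatureE /curvature_expr addn0 [RHS]/=; jet_field.
have [_ S0] := nd _ Dx.
rewrite -[LHS]/(speed y x * derive1 (iter j (dds y) (curvature y)) x) derive1E.
have dw := is_derive_inv_sqrt_S2 sy Dx S0.
have := is_derive_eq_on oD (fun t Dt => esym (ih t Dt)) Dx
  (is_derive_jet_eval (curvature_expr R j) sy Dx dw).
case=> _ ->; rewrite /curvature_expr [derivation _ _]/= [jet_eval _ _ _ _ in
  RHS]/=.
rewrite addnS [jet_eval _ _ _ _ in LHS]/=.
set lead := jet_eval _ _ _ (lead_coeff_expr R j).
set dl := jet_eval _ _ _ (derivation _ (lead_coeff_expr R j)).
set dlow := jet_eval _ _ _ (derivation _ _).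
by rewrite /speed; move: lead dl dlow; jet_field.
Qed.

(** The coordinates w, x, y, y_x, ... of a normalized jet, as polynomials in
    the variables k_0, k_1, ... that stand for the derivatives of k. The first
    seven are the normalization; each further one solves d^n k / ds^n = k_n,
    where the highest derivative has coefficient 1. *)
Fixpoint normal_jet_expr (R : realType) (sigma : R) (n : nat) : seq (expr R) :=
  match n with
  | 0 => [:: Const (Num.sqrt 3)^-1; Const 0; Const 0; Const 0; Const 1; Const 0;
             Const sigma]
  | n.+1 => let s := normal_jet_expr sigma n in
      rcons s (Add (Var n)
        (Mul (Const (-1)) (subst (nth (Const 0) s) (lower_expr R n))))
  end.

Lemma size_normal_jet_expr (R : realType) (sigma : R) (n : nat) :
  size (normal_jet_expr sigma n) = (7 + n)%N.
Proof. by elim: n => //= n ih; rewrite size_rcons ih addnS. Qed.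

Definition normal_jet (R : realType) (sigma : R) (n : nat) (k : nat -> R)
    (i : nat) : R :=
  eval k (nth (Const 0) (normal_jet_expr sigma n) i).

Lemma lead_coeff_normal (R : realType) (z : nat -> R) (j : nat) :
  z 0%N = (Num.sqrt 3)^-1 -> z 4%N = 1 -> eval z (lead_coeff_expr R j) = 1.
Proof.
move=> z0 z4; have s0 := sqrt3_neq0 R; have s3 := sqrt3_sq R.
elim: j => [|j ih] /=; rewrite ?ih z0 z4; last by field.
by rewrite -{1}s3; field.
Qed.

(** A curve whose 4-jet is normalized has its higher jet determined by k and
    its derivatives, one coordinate after the other. *)
Lemma normal_jetE (R : realType) (sigma : R) (n : nat) (k z : nat -> R) :
  (forall i, (i < 7)%N -> z i = normal_jet sigma 0 k i) ->
  (forall j, (j < n)%N -> k j = eval z (curvature_expr R j)) ->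
  forall i, (i < 7 + n)%N -> z i = normal_jet sigma n k i.
Proof.
move=> z7; elim: n => [|n ih] kz i; first by rewrite addn0 => /z7.
have {}ih := ih (fun j jn => kz j (ltnW jn)).
rewrite addnS ltnS leq_eqVlt /normal_jet /= nth_rcons size_normal_jet_expr.
case/orP => [/eqP -> |lt_i]; last by rewrite lt_i ih.
rewrite ltnn eqxx /= eval_subst kz// /curvature_expr /=.
rewrite lead_coeff_normal ?(z7 0%N) ?(z7 4%N)// mul1r.
rewrite (eq_eval (vars_below_lower R n) (z' := fun j => normal_jet sigma n k
  j))//.
by rewrite mulN1r addrK.
Qed.

(** * Smooth functions of several variables *)

Lemma smooth_on_derive (R : realType) (n : nat) (U : set 'rV[R]_n)
    (F : 'rV[R]_n -> R) (v : 'rV[R]_n) :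
  smooth_on U F -> smooth_on U ('D_v F).
Proof. by move=> sF vs p Up; have := sF (rcons vs v) p Up;
  rewrite foldr_rcons. Qed.

Lemma smooth_on_differentiable (R : realType) (n : nat) (U : set 'rV[R]_n)
    (F : 'rV[R]_n -> R) (p : 'rV[R]_n) :
  smooth_on U F -> U p -> differentiable F p.
Proof. by move=> sF Up; exact: (sF [::] p Up). Qed.

(** Smoothness order by order, for all directions: the bound N makes it
    possible to prove the product and chain rules by induction. *)
Fixpoint diff_upto (R : realType) (n : nat) (N : nat) (F : 'rV[R]_n -> R) :
  Prop :=
  (forall p, differentiable F p) /\
  match N with
  | 0 => True
  | N.+1 => forall v : 'rV[R]_n, diff_upto N ('D_v F)
  end.

Lemma diff_uptoW (R : realType) (n N : nat) (F : 'rV[R]_n -> R) :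
  diff_upto N F -> forall p, differentiable F p.
Proof. by case: N => [|N] []. Qed.

Lemma diff_uptoS (R : realType) (n N : nat) (F : 'rV[R]_n -> R) :
  diff_upto N.+1 F -> diff_upto N F.
Proof.
elim: N F => [|N ih] F [dF DF]; first by split.
by split=> // v; exact: ih (DF v).
Qed.

Lemma smooth_onTP (R : realType) (n : nat) (F : 'rV[R]_n -> R) :
  smooth_on setT F <-> forall N, diff_upto N F.
Proof.
split=> [sF N|dF vs]; last first.
  elim/last_ind: vs F dF => [|vs v ih] F dF p _;
    first exact: diff_uptoW (dF 0%N) p.
  by rewrite foldr_rcons; apply: ih => // N; exact: (dF N.+1).2.
have dF G : smooth_on setT G -> forall p, differentiable G p.
  by move=> sG p; exact: smooth_on_differentiable sG _.
elim: N F sF => [|N ih] F sF; first by split=> //; exact: dF.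
by split=> [|v]; [exact: dF|exact/ih/smooth_on_derive].
Qed.

Lemma diff_upto_cst (R : realType) (n N : nat) (c : R) :
  diff_upto N (cst c : 'rV[R]_n -> R).
Proof.
elim: N c => [|N ih] c; split=> // v.
have -> : 'D_v (cst c : 'rV[R]_n -> R) = cst 0.
  by apply/funext => p; exact: derive_cst.
exact: ih.
Qed.

Lemma diff_upto_coord (R : realType) (n N : nat) (i : 'I_n) :
  diff_upto N (fun p : 'rV[R]_n => p 0 i).
Proof.
case: N => [|N]; split=> //; try by move=> p; exact: differentiable_coord.
move=> v; rewrite (_ : 'D_v _ = cst (v 0 i)); first exact: diff_upto_cst.
apply/funext => p.
have : derivable (fun q : 'rV[R]_n => q) p v by exact: derivable_id.
move=> /derive_mx /matrixP/(_ 0 i); rewrite mxE derive_id => ->.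
by congr ('D_v _ p).
Qed.

Lemma diff_uptoD (R : realType) (n N : nat) (F G : 'rV[R]_n -> R) :
  diff_upto N F -> diff_upto N G -> diff_upto N (fun p => F p + G p).
Proof.
elim: N F G => [|N ih] F G [dF DF] [dG DG]; split=> //; try by move=> p;
  exact: differentiableD.
move=> v; rewrite (_ : 'D_v _ = fun p => 'D_v F p + 'D_v G p).
  by apply: ih; [exact: DF|exact: DG].
by apply/funext => p; rewrite -deriveD//; exact: diff_derivable.
Qed.

Lemma diff_uptoM (R : realType) (n N : nat) (F G : 'rV[R]_n -> R) :
  diff_upto N F -> diff_upto N G -> diff_upto N (fun p => F p * G p).
Proof.
elim: N F G => [|N ih] F G hF hG; have := (hF, hG) => -[[dF DF] [dG DG]];
  split=> //;
  try by move=> p; exact: differentiableM.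
move=> v; rewrite (_ : 'D_v _ = fun p => F p * 'D_v G p + G p * 'D_v F p).
  by apply: diff_uptoD; apply: ih;
    first [exact: DF|exact: DG|exact: diff_uptoS hF|exact: diff_uptoS hG].
by apply/funext => p; rewrite -[LHS]/('D_v (F * G) p) deriveM//;
  exact: diff_derivable.
Qed.

Lemma diff_upto_sum (R : realType) (n m N : nat) (F : 'I_m -> 'rV[R]_n -> R) :
  (forall i, diff_upto N (F i)) -> diff_upto N (fun p => \sum_i F i p).
Proof.
elim: m F => [|m ih] F dF.
  rewrite (_ : (fun p => _) = cst 0); first exact: diff_upto_cst.
  by apply/funext => p; rewrite big_ord0.
rewrite (_ : (fun p => _) =
    fun p => \sum_(i < m) F (widen_ord (leqnSn m) i) p + F ord_max p).
  by apply: diff_uptoD => //; exact: ih.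
by apply/funext => p; rewrite big_ord_recr.
Qed.

Lemma differentiable_row (R : realType) (m n : nat) (P : 'rV[R]_m -> 'rV[R]_n)
    (k : 'rV[R]_m) :
  (forall j, differentiable (fun q => P q 0 j) k) -> differentiable P k.
Proof.
move=> dP; have -> : P = \sum_(j < n) (fun q => P q 0 j *: delta_mx 0 j).
  by apply/funext => q; rewrite fct_sumE {1}[P q]row_sum_delta.
by apply: differentiable_sum => j; exact: differentiableZl.
Qed.

(** The chain rule in coordinates: it expresses a derivative of F o P by sums
    and products of functions of the same kind, which closes the induction on
    the order. *)
Lemma derive_comp_row (R : realType) (m n : nat) (F : 'rV[R]_n -> R)
    (P : 'rV[R]_m -> 'rV[R]_n) (k v : 'rV[R]_m) :
  differentiable F (P k) -> (forall j, differentiable (fun q => P q 0 j) k) ->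
  'D_v (F \o P) k =
  \sum_j 'D_(delta_mx 0 j) F (P k) * 'D_v (fun q => P q 0 j) k.
Proof.
move=> dF dPj; have dP := differentiable_row dPj.
rewrite deriveE; last exact: differentiable_comp.
rewrite diff_comp//= -[X in 'd F _ X]/('d P k v) -(deriveE _ dP) derive_mx;
  last exact: diff_derivable.
rewrite [X in 'd F _ X]row_sum_delta linear_sum; apply: eq_bigr => j _.
by rewrite linearZ/= -deriveE// mulrC mxE.
Qed.

(** The derivatives of F o P at k only involve those of F at the point P k, so
    that control of F on V suffices. *)
Lemma diff_upto_comp (R : realType) (m n N : nat) (V : set 'rV[R]_n)
    (F : 'rV[R]_n -> R) (P : 'rV[R]_m -> 'rV[R]_n) :
  smooth_on V F -> (forall j N, diff_upto N (fun q => P q 0 j)) ->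
  (forall k, V (P k)) -> diff_upto N (F \o P).
Proof.
move=> + sP VP; have dP k j := diff_uptoW (sP j 0%N) k.
elim: N F => [|N ih] F sF; split=> //.
- by move=> k; apply: differentiable_comp;
    [exact: differentiable_row|exact: smooth_on_differentiable sF _].
- by move=> k; apply: differentiable_comp;
    [exact: differentiable_row|exact: smooth_on_differentiable sF _].
move=> v; rewrite (_ : 'D_v _ = fun k =>
    \sum_j ('D_(delta_mx 0 j) F \o P) k * 'D_v (fun q => P q 0 j) k).
  apply: diff_upto_sum => j; apply: diff_uptoM; first exact/ih/smooth_on_derive.
  exact: (sP j N.+1).2.
by apply/funext => k; rewrite derive_comp_row//;
  exact: smooth_on_differentiable sF _.
Qed.

(** The default value 0 is never met: the polynomials that give a normalized
    r-jet only contain the variables below r, and k has r entries there. *)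
Definition coord_or0 (R : realType) (m : nat) (k : 'rV[R]_m) (i : nat) : R :=
  if insub i is Some j then k 0 j else 0.

Lemma diff_upto_eval (R : realType) (m N : nat) (e : expr R) :
  diff_upto N (fun k : 'rV[R]_m => eval (coord_or0 k) e).
Proof.
elim: e => [c|i|e1 ih1 e2 ih2|e1 ih1 e2 ih2] /=.
- exact: diff_upto_cst.
- rewrite /coord_or0; case: insub => [j|]; first exact: diff_upto_coord.
  exact: diff_upto_cst.
- exact: diff_uptoD.
- exact: diff_uptoM.
Qed.

(** * The curvature function is invariant *)

(** On a regular curve sigma = S2 / |S2| is differentiable, and its derivative
    vanishes. *)
Lemma signature_constant (R : realType) (D : set R) (y : R -> R) (x x' : R) :
  regular D y -> D x -> D x' -> signature y x = signature y x'.
Proof.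
move=> [[oD iD _] sy nd]; apply: is_derive0_constant => // {x'} {}x Dx.
have S0 t : D t -> S2 y t != 0 by move=> /nd[].
have dw := is_derive_inv_sqrt_S2 sy Dx (S0 _ Dx).
pose E : expr R := Mul (S2_expr R) (Mul (Var 0) (Var 0)).
have sigE t : D t -> jet_eval (inv_sqrt_S2 y) y t E = signature y t.
  by move=> Dt; rewrite signatureE ?S0// expr2 -(jet_eval_S2 (inv_sqrt_S2 y)).
apply: (is_derive_eq_on oD sigE Dx).
apply: (@is_derive_eq _ _ _ _ _ _ _ _ (is_derive_jet_eval E sy Dx dw)).
set dS : R := jet_eval (inv_sqrt_S2 y) y x (dS2_expr R).
transitivity (dS * inv_sqrt_S2 y x ^+ 2
  * (1 - inv_sqrt_S2 y x ^+ 4 * S2 y x ^+ 2)).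
  by rewrite [LHS]/= /S2 /dS [jet_eval _ _ _ _ in RHS]/=; jet_field.
by rewrite inv_sqrt_S2_pow4 ?S0// subrr mulr0.
Qed.

Lemma arc_parameter_exists (R : realType) (D : set R) (y : R -> R) :
  regular D y -> exists s, arc_parameter D y s.
Proof.
move=> reg; have [[oD iD _] _ _] := reg.
apply: antiderivative => // x Dx.
have [[ds _] _] := frenet_equations reg Dx.
have -> : arc_element y = fun t => (speed y t)^-1.
  by apply/funext => t; rewrite arc_elementE.
exact: is_derive_continuous (is_deriveV (speed_neq0 reg Dx) ds).
Qed.

Lemma arc_parameter_inj (R : realType) (D : set R) (y s : R -> R) :
  regular D y -> arc_parameter D y s ->
  forall x x', D x -> D x' -> s x = s x' -> x = x'.
Proof.
move=> reg ds; have [[_ iD _] _ _] := reg.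
apply: is_derive_neq0_inj iD ds _ => x Dx.
by rewrite arc_elementE invr_eq0 (speed_neq0 reg Dx).
Qed.

(** Invariance of the arc element makes s2 o phi - s1 locally constant, so that
    s2 can be shifted to match s1; the curvature is then carried over point by
    point. *)
Lemma curvature_function_invariant (R : realType) (a b c d e f : R)
    (D1 : set R) (y1 : R -> R) (D2 : set R) (y2 : R -> R) :
  regular D1 y1 -> regular D2 y2 -> 0 < a * d - b * c ->
  maps_curve a b c d e f D1 y1 D2 y2 ->
  (forall x2, D2 x2 -> exists2 x, D1 x & x2 = a * x + b * y1 x + e) ->
  same_signature D1 y1 D2 y2 /\
  exists (s1 s2 : R -> R) (J : set R) (K : R -> R),
    [/\ curvature_function D1 y1 s1 J K, curvature_function D2 y2 s2 J K &
        forall x, D1 x -> s2 (a * x + b * y1 x + e) = s1 x].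
Proof.
move=> reg1 reg2 det_gt0 m surj.
have [[oD1 iD1 [x0 Dx0]] sy1 nd1] := reg1; have [[_ _ _] sy2 nd2] := reg2.
have S0 t : D1 t -> S2 y1 t != 0 by move=> /nd1[].
split=> [x1 x2 Dx1 /surj[x Dx ->]|].
  by rewrite (image_signature oD1 sy1 sy2 det_gt0 m Dx (S0 _ Dx));
    exact: signature_constant reg1 Dx1 Dx.
have [s1 ds1] := arc_parameter_exists reg1.
have [s ds] := arc_parameter_exists reg2.
pose phi x := a * x + b * y1 x + e.
(* s o phi and s1 have the same derivative. *)
have sphi x x' : D1 x -> D1 x' -> s (phi x) - s1 x = s (phi x') - s1 x'.
  apply: (@is_derive0_constant R D1 (fun t => s (phi t) - s1 t)) =>
    // {x'} {}x Dx.
  have dsphi := @is_derive1_comp R s phi x _ _ (ds _ (m _ Dx).1)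
    (is_derive_affine_comb a b e sy1 Dx).
  apply: (@is_derive_eq _ _ _ _ _ _ _ _ (is_deriveB dsphi (ds1 _ Dx))).
  rewrite !arc_elementE (image_speed oD1 sy1 sy2 det_gt0 m Dx (S0 _ Dx)).
  have q0 := maps_curve_slope_neq0 oD1 sy1 sy2 (lt0r_neq0 det_gt0) m Dx.
  by rewrite invfM -mulrA mulVf// mulr1 subrr.
pose s2 t := s t - (s (phi x0) - s1 x0).
have s2phi x : D1 x -> s2 (phi x) = s1 x.
  by move=> Dx; rewrite /s2 (sphi x0 x)// opprB addrC subrK.
have inj1 := arc_parameter_inj reg1 ds1.
pose K t := curvature y1 (xget 0 [set x | D1 x /\ s1 x = t]).
have KE x : D1 x -> K (s1 x) = curvature y1 x.
  move=> Dx; rewrite /K; case: xgetP => [x' _ [Dx' sx']|/(_ x)[]//].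
  by rewrite (inj1 _ _ Dx' Dx sx').
exists s1, s2, (s1 @` D1), K; split; [by split| |exact: s2phi].
split.
- move=> x Dx; have := is_deriveB (ds _ Dx) (is_derive_cst (s (phi x0) - s1 x0)
    x 1).
  by rewrite subr0.
- apply/seteqP; split=> [_ [_ /surj[x Dx ->] <-]|_ [x Dx <-]].
    by exists x => //; rewrite s2phi.
  by exists (phi x); [exact: (m _ Dx).1|rewrite s2phi].
- move=> _ /surj[x Dx ->]; rewrite (image_curvature reg1 reg2 det_gt0 m Dx).
  by rewrite -(KE _ Dx) -(s2phi _ Dx).
Qed.

(** * The curvature function and the signature determine the curve *)

(** The quotient u / v has derivative zero. *)
Lemma ratio_constant (R : realType) (D : set R) (u v m : R -> R) :
  is_interval D -> (forall x, D x -> is_derive x 1 u (m x * u x)) ->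
  (forall x, D x -> is_derive x 1 v (m x * v x)) ->
  (forall x, D x -> v x != 0) ->
  exists c, forall x, D x -> u x = c * v x.
Proof.
move=> iD du dv v0.
have [[x0 Dx0]|noD] := pselect (D !=set0); last first.
  by exists 0 => x Dx; case: noD; exists x.
exists (u x0 / v x0) => x Dx.
suff -> : u x0 / v x0 = u x / v x by rewrite mulfVK ?v0.
apply: (@is_derive0_constant R D (fun t => u t / v t)) => // {Dx} {}x Dx.
have dV := is_deriveV (v0 _ Dx) (dv _ Dx).
apply: (@is_derive_eq _ _ _ _ _ _ _ _ (is_deriveM (du _ Dx) dV)).
rewrite /GRing.scale/= -exprVn; move: (u x) (v x) (m x) (v0 _ Dx) => a b c b0.
by field.
Qed.

(** Liouville's formula: the derivative of the determinant of two solutions is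
    this determinant times the trace of the system. *)
Lemma is_derive_frenet_det (R : realType) (y f1 f2 g1 g2 : R -> R) (x : R) :
  frenet y f1 f2 x -> frenet y g1 g2 x ->
  is_derive x 1 (fun t => f1 t * g2 t - f2 t * g1 t)
    (- (3 / 2) * (signature y x * curvature y x) / speed y x
     * (f1 x * g2 x - f2 x * g1 x)).
Proof.
move=> [df1 df2] [dg1 dg2].
apply: (@is_derive_eq _ _ _ _ _ _ _ _
  (is_deriveB (is_deriveM df1 dg2) (is_deriveM df2 dg1))).
rewrite /GRing.scale/=.
move: (signature y x) (curvature y x) (speed y x)^-1 (f1 x) (f2 x) (g1 x) (g2 x).
by move=> sg k w a1 a2 b1 b2; field.
Qed.

Definition frame_det (R : realType) (y : R -> R) (x : R) : R :=
  speed y x * normal_y y x - normal_x y x * tangent_y y x.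

Lemma frame_det_gt0 (R : realType) (D : set R) (y : R -> R) (x : R) :
  regular D y -> D x -> 0 < frame_det y x.
Proof.
move=> [_ _ nd] Dx; have [y20 S0] := nd _ Dx.
have -> : frame_det y x =
    3 * Num.sqrt 3 * derive1n 2 y x ^+ 4 * inv_sqrt_S2 y x ^+ 3.
  by rewrite /frame_det /tangent_y /normal_y /normal_x /speed; jet_field.
have y24 : 0 < derive1n 2 y x ^+ 4 by rewrite exprn_even_gt0.
have w3 : 0 < inv_sqrt_S2 y x ^+ 3 by rewrite exprn_gt0// inv_sqrt_S2_gt0.
by rewrite mulr_gt0// mulr_gt0// mulr_gt0// sqrtr_gt0.
Qed.

(** Cramer's rule: the coefficients of a solution on the basis formed by the
    frame are quotients of determinants, which are constant because numerator
    and denominator satisfy the same equation. *)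
Lemma frenet_solution (R : realType) (D : set R) (y f1 f2 : R -> R) :
  regular D y -> (forall x, D x -> frenet y f1 f2 x) ->
  exists a b, forall x, D x ->
    f1 x = a * speed y x + b * tangent_y y x /\
    f2 x = a * normal_x y x + b * normal_y y x.
Proof.
move=> reg fF; have [[_ iD _] _ _] := reg.
have det0 x : D x -> frame_det y x != 0 by move=> Dx;
  rewrite gt_eqF// (frame_det_gt0 reg Dx).
have F x (Dx : D x) := frenet_equations reg Dx.
have dF x (Dx : D x) := is_derive_frenet_det (F _ Dx).1 (F _ Dx).2.
have [a aE] := ratio_constant iD
  (fun x Dx => is_derive_frenet_det (fF x Dx) (F x Dx).2) dF det0.
have [b bE] := ratio_constant iD
  (fun x Dx => is_derive_frenet_det (F x Dx).1 (fF x Dx)) dF det0.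
exists a, b => x Dx; have := aE _ Dx; have := bE _ Dx; move: (det0 _ Dx).
rewrite /frame_det.
move: (f1 x) (f2 x) (speed y x) (tangent_y y x) (normal_x y x) (normal_y y x).
move=> p q e1 e1' e2 e2' d0 bE' aE'.
split; apply: (mulIf d0).
  transitivity (e1 * (p * e2' - q * e1') + e1' * (e1 * q - e2 * p));
    first by ring.
  by rewrite aE' bE'; ring.
transitivity (e2 * (p * e2' - q * e1') + e2' * (e1 * q - e2 * p)); first by ring.
by rewrite aE' bE'; ring.
Qed.

(** Parametrizing a curve by a corresponding point of another one with the same
    arc element, signature and curvature transports solutions of its system to
    solutions of the other system. *)
Lemma frenet_comp (R : realType) (y1 y2 f1 f2 theta : R -> R) (x : R) :
  is_derive x 1 theta (speed y2 (theta x) / speed y1 x) ->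
  speed y2 (theta x) != 0 ->
  signature y2 (theta x) = signature y1 x ->
  curvature y2 (theta x) = curvature y1 x ->
  frenet y2 f1 f2 (theta x) -> frenet y1 (f1 \o theta) (f2 \o theta) x.
Proof.
move=> dtheta s0 sgE kE [d1 d2].
have cancel_speed (A s1 s2 : R) : s2 != 0 -> A / s1 = A / s2 * (s2 / s1).
  by move=> s20; rewrite mulrA mulfVK.
split; rewrite -sgE -kE (cancel_speed _ (speed y1 x) _ s0).
  exact: is_derive1_comp d1 dtheta.
exact: is_derive1_comp d2 dtheta.
Qed.

(** The bijection theta = s2^-1 o s1 matches the points with equal arc
    parameter. The frame of the second curve at theta x is a constant linear
    image of that of the first at x, and integrating the first vectors of the
    frames gives the map between the curves. *)
Lemma curvature_function_congruent (R : realType) (D1 : set R) (y1 : R -> R)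
    (D2 : set R) (y2 : R -> R) (s1 s2 : R -> R) (J : set R) (K : R -> R) :
  regular D1 y1 -> regular D2 y2 -> same_signature D1 y1 D2 y2 ->
  curvature_function D1 y1 s1 J K -> curvature_function D2 y2 s2 J K ->
  exists a b c d e f : R,
    [/\ 0 < a * d - b * c, maps_curve a b c d e f D1 y1 D2 y2 &
        forall x2, D2 x2 -> exists2 x, D1 x & x2 = a * x + b * y1 x + e].
Proof.
move=> reg1 reg2 sg12 [ds1 J1 K1] [ds2 J2 K2].
have [[oD1 iD1 [x0 Dx0]] sy1 nd1] := reg1.
have [[oD2 iD2 _] sy2 nd2] := reg2.
have inj2 := arc_parameter_inj reg2 ds2.
have [g gK] : exists g : R -> R, forall x, D2 x ->
    g (s2 x) = x /\ is_derive (s2 x) 1 g (arc_element y2 x)^-1.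
  apply: interval_inverse ds2 _ => // x Dx.
  by rewrite arc_elementE invr_eq0 (speed_neq0 reg2 Dx).
pose theta x := g (s1 x).
have thetaP x : D1 x -> D2 (theta x) /\ s2 (theta x) = s1 x.
  move=> Dx; have : J (s1 x) by rewrite -J1; exists x.
  by rewrite -J2 => -[x2 Dx2 s2E]; rewrite /theta -s2E (gK _ Dx2).1.
have dtheta x : D1 x -> is_derive x 1 theta (speed y2 (theta x) / speed y1 x).
  move=> Dx; have [Dt sE] := thetaP _ Dx; have [_] := gK _ Dt.
  rewrite sE arc_elementE invrK => dg; have := ds1 _ Dx; rewrite arc_elementE.
  exact: is_derive1_comp dg.
have frenet2 x f1 f2 : D1 x -> frenet y2 f1 f2 (theta x) ->
    frenet y1 (f1 \o theta) (f2 \o theta) x.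
  move=> Dx; have [Dt sE] := thetaP _ Dx.
  apply: frenet_comp (dtheta _ Dx) (speed_neq0 reg2 Dt) (esym (sg12 _ _ Dx Dt)) _.
  by rewrite -(K2 _ Dt) sE K1.
have [a [b abE]] := frenet_solution reg1
  (fun x Dx => frenet2 x _ _ Dx (frenet_equations reg2 (thetaP x Dx).1).1).
have [c [d cdE]] := frenet_solution reg1
  (fun x Dx => frenet2 x _ _ Dx (frenet_equations reg2 (thetaP x Dx).1).2).
have speed10 x : D1 x -> speed y1 x != 0 by move=> Dx;
  rewrite (speed_neq0 reg1 Dx).
have affine_cst (h : R -> R) (p q : R) :
    (forall x, D1 x -> is_derive x 1 h (p + q * derive1n 1 y1 x)) ->
    forall x, D1 x -> h x = p * x + q * y1 x + (h x0 - (p * x0 + q * y1 x0 + 0)).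
  move=> dh x Dx.
  suff <- : h x - (p * x + q * y1 x + 0) = h x0 - (p * x0 + q * y1 x0 + 0).
    by rewrite addr0 addrC subrK.
  apply: (@is_derive0_constant R D1 (fun t => h t - (p * t + q * y1 t + 0))) =>
    //.
  move=> {Dx} {}x Dx.
  have := is_deriveB (dh _ Dx) (is_derive_affine_comb p q 0 sy1 Dx).
  by rewrite subrr.
have slope (A B : R) x : D1 x ->
    (A * speed y1 x + B * tangent_y y1 x) / speed y1 x = A + B * derive1n 1 y1 x.
  move=> /speed10; rewrite /tangent_y; move: (speed y1 x) (derive1n 1 y1 x).
  by move=> u p u0; field.
have [e thetaE] : exists e, forall x, D1 x -> theta x = a * x + b * y1 x + e.
  eexists; apply: affine_cst => x Dx.
  by rewrite -slope// -(abE _ Dx).1; exact: dtheta.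
have [f yE] : exists f, forall x, D1 x -> y2 (theta x) = c * x + d * y1 x + f.
  eexists; apply: (affine_cst (y2 \o theta)) => x Dx.
  rewrite -slope// -(cdE _ Dx).1 /= /tangent_y.
  have dy2 := is_derive_derive1n 0 sy2 (thetaP _ Dx).1.
  have := is_derive1_comp dy2 (dtheta _ Dx).
  by rewrite mulrA [X in X / _]mulrC.
exists a, b, c, d, e, f.
split.
- have [[/= e1 e2] [/= e3 e4]] := (abE _ Dx0, cdE _ Dx0).
  have : 0 < frame_det y2 (theta x0) by exact: frame_det_gt0 reg2 (thetaP _
    Dx0).1.
  have -> : frame_det y2 (theta x0) = (a * d - b * c) * frame_det y1 x0.
    by rewrite /frame_det e1 e2 e3 e4; ring.
  by rewrite pmulr_lgt0 ?(frame_det_gt0 reg1 Dx0).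
- by move=> x Dx; rewrite -thetaE// yE//; have [] := thetaP _ Dx.
- move=> x2 Dx2; have : J (s2 x2) by rewrite -J2; exists x2.
  rewrite -J1 => -[x Dx sE]; exists x => //; rewrite -thetaE//.
  have [Dt st] := thetaP _ Dx; apply: inj2 => //.
  by rewrite st sE.
Qed.

(** * Normal form of a jet *)

Lemma near_open_interval (R : realType) (P : set R) (x : R) :
  (\forall t \near x, P t) ->
  exists D : set R, [/\ open D, is_interval D, D x & D `<=` P].
Proof.
move=> /nbhs_ballP[e /= e0 eP]; exists `]x - e, x + e[%classic; split.
- exact: itv_open.
- exact: interval_is_interval.
- by rewrite /= in_itv/= ltrBlDr ltrDl e0.
- by move=> t; rewrite /= in_itv/= => /andP[h1 h2]; apply: eP;
    rewrite /ball/= ltr_norml; apply/andP; split; lra.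
Qed.

Lemma image_curvature_derivatives (R : realType) (a b c d e f : R)
    (D1 : set R) (y1 : R -> R) (D2 : set R) (y2 : R -> R) (j : nat) (x : R) :
  regular D1 y1 -> regular D2 y2 -> 0 < a * d - b * c ->
  maps_curve a b c d e f D1 y1 D2 y2 -> D1 x ->
  iter j (dds y2) (curvature y2) (a * x + b * y1 x + e) =
  iter j (dds y1) (curvature y1) x.
Proof.
move=> reg1 reg2 det_gt0 m; elim: j x => [|j ih] x Dx.
  exact: image_curvature reg1 reg2 det_gt0 m Dx.
have [[oD1 _ _] sy1 nd1] := reg1; have [[oD2 _ _] sy2 nd2] := reg2.
have [D2x _] := m _ Dx.
have dw := is_derive_inv_sqrt_S2 sy2 D2x (nd2 _ D2x).2.
have [dk _] := is_derive_eq_on oD2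
  (fun t Dt => esym (curvature_exprE j reg2 Dt)) D2x
  (is_derive_jet_eval (curvature_expr R j) sy2 D2x dw).
exact: image_dds oD1 sy1 sy2 det_gt0 m Dx (nd1 _ Dx).2 ih dk.
Qed.

(** A frame equal to the standard basis forces y_x = 0 (direction of the
    tangent) and y_xxx = 0 (direction of the normal); the two other components
    then give y_xx = 1 and |S2| = 3. *)
Lemma normal_4jet (R : realType) (D : set R) (y : R -> R) (k : nat -> R) :
  regular D y -> D 0 -> y 0 = 0 ->
  speed y 0 = 1 -> tangent_y y 0 = 0 -> normal_x y 0 = 0 -> normal_y y 0 = 1 ->
  forall i, (i < 7)%N ->
    jet_var (inv_sqrt_S2 y) y i 0 = normal_jet (signature y 0) 0 k i.
Proof.
move=> [_ _ nd] D0 y00 sp; have [] := nd _ D0; rewrite /S1 => y20 S0.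
rewrite /tangent_y sp mul1r => y1E.
rewrite /normal_x /normal_y signatureE// y1E mul0r subr0 => nx ny.
have w0 : inv_sqrt_S2 y 0 != 0 by rewrite gt_eqF// inv_sqrt_S2_gt0.
have y3E : derive1n 3 y 0 = 0.
  move: (derive1n 3 y 0) nx => z /eqP; rewrite oppr_eq0 mulf_eq0.
  by rewrite (negbTE (mulf_neq0 y20 (expf_neq0 2 w0))) => /eqP.
have y2E : derive1n 2 y 0 = 1.
  have : speed y 0 ^+ 2 = 1 by rewrite sp expr1n.
  rewrite /speed !exprMn sqrt3_sq => sq.
  rewrite -[RHS]ny -[LHS]mulr1 -[X in _ * X = _]sq.
  by clear; move: (inv_sqrt_S2 y 0) (derive1n 2 y 0) => w u; ring.
have wE : inv_sqrt_S2 y 0 = (Num.sqrt 3)^-1.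
  have s0 := sqrt3_neq0 R; apply: (mulfI s0); rewrite mulfV//.
  by move: sp; rewrite /speed y2E mulr1.
have SE : S2 y 0 * inv_sqrt_S2 y 0 ^+ 2 = derive1n 4 y 0.
  rewrite /S2 y2E y3E wE exprVn sqrt3_sq; move: (derive1n 4 y 0) => z.
  by field.
rewrite SE; case=> [|[|[|[|[|[|[|i]]]]]]] lt_i7.
- exact: wE.
- exact: erefl.
- exact: y00.
- exact: y1E.
- exact: y2E.
- exact: y3E.
- exact: erefl.
- by case: (notF lt_i7).
Qed.

(** The coordinates (x, y, y_x, ...) of the normalized jet; the shift by one
    skips the auxiliary coordinate w. *)
Definition normal_row (R : realType) (sigma : R) (r : nat) (k : nat -> R) :
    'rV[R]_r.+2 :=
  \row_(i < r.+2) normal_jet sigma r k (val i).+1.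

(** The affine map is chosen with the inverse of the frame at the point as its
    linear part, and with the translation bringing the point to the origin. The
    curve is restricted to a neighbourhood on which no tangent becomes
    vertical, so that its image is again a regular curve; there the frame is
    the standard basis. *)
Lemma jet_normalization (R : realType) (r : nat) (F : 'rV[R]_r.+2 -> R)
    (D : set R) (y : R -> R) (x : R) (k : nat -> R) :
  (forall (D1 : set R) (y1 : R -> R) (D2 : set R) (y2 : R -> R)
     (a b c d e f : R) (x1 : R),
     regular D1 y1 -> regular D2 y2 -> 0 < a * d - b * c ->
     maps_curve a b c d e f D1 y1 D2 y2 ->
     (forall x2, D2 x2 -> exists2 x, D1 x & x2 = a * x + b * y1 x + e) ->
     D1 x1 -> F (jet r y1 x1) = F (jet r y2 (a * x1 + b * y1 x1 + e))) ->
  regular D y -> D x ->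
  (forall j, (j < r)%N -> k j = iter j (dds y) (curvature y) x) ->
  F (jet r y x) = F (normal_row (signature y x) r k).
Proof.
move=> invF reg Dx kE; have [[oD _ _] sy nd] := reg.
have det_gt0 := frame_det_gt0 reg Dx.
have det0 : frame_det y x != 0 by rewrite gt_eqF.
(* Cramer's formulas for the inverse of the frame. *)
pose Dt := frame_det y x.
pose a := normal_y y x / Dt; pose b := - normal_x y x / Dt.
pose c := - tangent_y y x / Dt; pose d := speed y x / Dt.
have adbc : a * d - b * c = Dt^-1.
  move: det0; rewrite /a /b /c /d /Dt /frame_det.
  move: (speed y x) (tangent_y y x) (normal_x y x) (normal_y y x) => t1 t2 n1
    n2 d0.
  by field.
have ad0 : 0 < a * d - b * c by rewrite adbc invr_gt0.
have sp0 := speed_neq0 reg Dx.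
have qx : a + b * derive1n 1 y x = (speed y x)^-1.
  have aE : a * speed y x + b * tangent_y y x = 1.
    by rewrite /a /b; move: det0; rewrite /Dt /frame_det;
      move: (speed y x) (tangent_y y x) (normal_x y x) (normal_y y x) => t1 t2
        n1 n2 d0; field.
  rewrite -[RHS]mul1r -aE /tangent_y; move: (speed y x) (derive1n 1 y x) sp0.
  by move: (a) (b) => A B s p s0; field.
have dq : is_derive x 1 (fun t => a + b * derive1n 1 y t) (b * derive1n 2 y x).
  have dy := is_derive_derive1n 1 sy Dx.
  by apply: is_derive_eq; rewrite /GRing.scale/=; jet_ring.
have nq : \forall t \near x, D t /\ a + b * derive1n 1 y t != 0.
  apply: filterS2 (near_open oD Dx) _ => [t Dt0 qt|]; first by split;
    [exact: Dt0|exact: qt].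
  have qx0 : a + b * derive1n 1 y x != 0 by rewrite qx invr_eq0.
  exact: (cvgr_neq0 _ (is_derive_continuous dq) qx0).
have [D1 [oD1 iD1 D1x D1P]] := near_open_interval nq.
have D1D t : D1 t -> D t by move=> /D1P[].
have q0 t : D1 t -> a + b * derive1n 1 y t != 0 by move=> /D1P[].
have sy1 : smooth_curve D1 y by move=> n t /D1D; exact: sy.
have reg1 : regular D1 y.
  by split=> //; [split=> //; exists x|move=> t /D1D/nd].
pose e := - (a * x + b * y x); pose f := - (c * x + d * y x).
have [D2 [y2 [oD2 iD2 sy2 m surj]]] := image_curve c d e f oD1 iD1 sy1 q0.
have frame t (D1t : D1 t) :=
  image_frame oD1 sy1 sy2 ad0 m D1t (nd _ (D1D _ D1t)).2.
have reg2 : regular D2 y2.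
  split=> //; first by split=> //; exists (a * x + b * y x + e);
    exact: (m _ D1x).1.
  move=> _ /surj[t D1t ->]; have [y20 S0] := nd _ (D1D _ D1t).
  have i0 : inv_slope a b y t != 0 by rewrite invr_eq0 q0.
  have [SE _ _ _ _] := frame _ D1t.
  have [_ zE _ _] := image_jet oD1 sy1 sy2 (lt0r_neq0 ad0) m D1t.
  rewrite SE /S1 zE; split; apply: mulf_neq0.
  - by apply: mulf_neq0; [exact: lt0r_neq0|exact: y20].
  - exact: expf_neq0.
  - by apply: expf_neq0; apply: mulf_neq0; [exact: lt0r_neq0|exact: expf_neq0].
  - exact: S0.
have x0 : a * x + b * y x + e = 0 by rewrite /e subrr.
have [D20 y20] := m _ D1x; rewrite x0 /f subrr in D20 y20.
have [_ sx ty nx ny] := frame _ D1x; rewrite x0 in sx ty nx ny.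
have sgE := image_signature oD1 sy1 sy2 ad0 m D1x (nd _ Dx).2.
rewrite (invF _ _ _ _ _ _ _ _ _ _ _ reg1 reg2 ad0 m surj D1x) x0; congr F.
rewrite x0 in sgE; rewrite -sgE.
have frame_eq : [/\ speed y2 0 = 1, tangent_y y2 0 = 0, normal_x y2 0 = 0 &
    normal_y y2 0 = 1].
  rewrite sx ty nx ny /a /b /c /d; move: det0; rewrite /Dt /frame_det.
  move: (speed y x) (tangent_y y x) (normal_x y x) (normal_y y x) => t1 t2 n1
    n2 d0.
  by split; field.
have [e1 e2 e3 e4] := frame_eq.
have z7 := normal_4jet k reg2 D20 y20 e1 e2 e3 e4.
have kz j : (j < r)%N ->
    k j = eval (fun i => jet_var (inv_sqrt_S2 y2) y2 i 0) (curvature_expr R j).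
  move=> jr; rewrite (kE _ jr).
  rewrite -(image_curvature_derivatives j reg1 reg2 ad0 m D1x) x0.
  exact: curvature_exprE reg2 D20.
have zE := normal_jetE z7 kz.
apply/rowP => i; rewrite !mxE -zE.
  by case: (val i) => [|j]; exact: erefl.
by apply: leq_ltn_trans (ltn_ord i) _; exact: (leq_addl 4 r).
Qed.

Lemma derive1n_horner (R : realType) (p : {poly R}) (n : nat) :
  derive1n n (horner p) = horner p^`(n).
Proof.
elim: n => [|n ih]; first by rewrite derive1n0 derivn0.
by rewrite derive1nS ih derivnS derivE.
Qed.

Lemma derive1n_taylor (R : realType) (u : nat -> R) (m n : nat) :
  (n < m)%N ->
  derive1n n (horner (\poly_(i < m) (u i / i`!%:R))) 0 = u n.
Proof.
move=> nm; rewrite derive1n_horner horner_coef0 coef_derivn addn0 coef_poly nm.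
by rewrite -[X in X = _]mulr_natr ffactnn mulfVK// pnatr_eq0 -lt0n fact_gt0.
Qed.

Lemma normal_jet_low (R : realType) (sigma : R) (n : nat) (k : nat -> R)
    (i : nat) :
  (i < 7)%N -> normal_jet sigma n k i = normal_jet sigma 0 k i.
Proof.
move=> i7; elim: n => //= n <-; rewrite /normal_jet /= nth_rcons.
by rewrite size_normal_jet_expr (leq_trans i7)// leq_addr.
Qed.

(** The Taylor polynomial with the prescribed derivatives at 0, near 0. It is
    taken of degree at least 4 even when r is smaller, so that the regularity
    conditions hold. *)
Lemma normal_row_regular (R : realType) (sigma : R) (r : nat) (k : nat -> R) :
  sigma != 0 -> @regular_jets R r (normal_row sigma r k).
Proof.
move=> sg0; pose u i := normal_jet sigma r k i.+2.
pose y := horner (\poly_(i < r + 5) (u i / i`!%:R)).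
have sy D : smooth_curve D y.
  by move=> n x _; rewrite /y derive1n_horner; exact: derivable_horner.
have yE n : (n < r + 5)%N -> derive1n n y 0 = u n by exact: derive1n_taylor.
have low i : (i < 5)%N -> derive1n i y 0 = normal_jet sigma 0 k i.+2.
  move=> i5; rewrite yE ?ltn_addl//; exact: normal_jet_low.
have y20 : S1 y 0 != 0 by rewrite /S1 low//; exact: oner_neq0.
have S20 : S2 y 0 != 0.
  have -> : S2 y 0 = 3 * sigma.
    by rewrite /S2 !low// /normal_jet /= mulr1 expr0n mulr0 subr0.
  by rewrite mulf_neq0// pnatr_eq0.
have c1 := is_derive_continuous (is_derive_derive1n 2 (sy setT) (I : setT 0)).
have c2 := is_derive_continuous (is_derive_S2 y (sy setT) (I : setT 0)).
have [D [oD iD D0 DP]] := near_open_interval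
  (filterI (cvgr_neq0 _ c1 y20) (cvgr_neq0 _ c2 S20)).
exists D, y, 0; split=> //.
  by split=> [||x /DP[]]; [split=> //; exists 0|exact: sy|split].
apply/rowP => i; rewrite !mxE.
case: i => [[|j] /= lt_j]; first by rewrite normal_jet_low.
by rewrite yE// (leq_trans (lt_j : j < r.+1)%N)// -addn1 leq_add2l.
Qed.

(** * Affine maps in coordinates *)

Lemma affine_pt (R : realType) (L : 'M[R]_2) (v : 'cV[R]_2) (x y : R) :
  affine L v (pt x y) =
  pt (L 0 0 * x + L 0 1 * y + v 0 0) (L 1 0 * x + L 1 1 * y + v 1 0).
Proof.
apply/colP => i; rewrite /affine /pt !mxE !big_ord_recl big_ord0 !mxE/= addr0.
have -> : lift ord0 ord0 = 1 :> 'I_2 by exact/val_inj.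
by case: i => [[|[|i]] lti] //=; congr (L _ _ * _ + L _ _ * _ + v _ _);
  exact/val_inj.
Qed.

Lemma pt_inj (R : realType) (x y x' y' : R) :
  pt x y = pt x' y' -> x = x' /\ y = y'.
Proof. by move=> /colP E; have := E 0; have := E 1; rewrite !mxE/= => -> ->. Qed.

Lemma det22 (R : realType) (L : 'M[R]_2) :
  \det L = L 0 0 * L 1 1 - L 0 1 * L 1 0.
Proof.
rewrite (expand_det_row _ 0) !big_ord_recl big_ord0 addr0 /cofactor !det_mx11
  !mxE/=.
have -> : lift ord0 ord0 = 1 :> 'I_2 by exact/val_inj.
have -> : lift 1 ord0 = 0 :> 'I_2 by exact/val_inj.
by rewrite /= !expr0 expr1 mul1r mulN1r mulrN.
Qed.

Lemma image_graphP (R : realType) (L : 'M[R]_2) (v : 'cV[R]_2)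
    (D1 : set R) (y1 : R -> R) (D2 : set R) (y2 : R -> R) :
  affine L v @` graph D1 y1 = graph D2 y2 <->
  maps_curve (L 0 0) (L 0 1) (L 1 0) (L 1 1) (v 0 0) (v 1 0) D1 y1 D2 y2 /\
  forall x2, D2 x2 -> exists2 x, D1 x & x2 = L 0 0 * x + L 0 1 * y1 x + v 0 0.
Proof.
split=> [LE|[m surj]].
  split=> [x Dx|x2 Dx2].
    have : (affine L v @` graph D1 y1) (affine L v (pt x (y1 x))).
      by exists (pt x (y1 x)) => //; exists x.
    by rewrite LE => -[x2 Dx2]; rewrite affine_pt => /pt_inj[<- <-].
  have : graph D2 y2 (pt x2 (y2 x2)) by exists x2.
  rewrite -LE => -[_ [x Dx <-]]; rewrite affine_pt => /pt_inj[xE _].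
  by exists x.
apply/seteqP; split=> [_ [_ [x Dx <-] <-]|_ [x2 /surj[x Dx xE] <-]].
  have [D2x yE] := m _ Dx.
  by exists (L 0 0 * x + L 0 1 * y1 x + v 0 0) => //; rewrite affine_pt yE.
exists (pt x (y1 x)); first by exists x.
by rewrite affine_pt xE (m _ Dx).2.
Qed.

Lemma image_graph_exists (R : realType) (a b c d e f : R)
    (D1 : set R) (y1 : R -> R) (D2 : set R) (y2 : R -> R) :
  maps_curve a b c d e f D1 y1 D2 y2 ->
  (forall x2, D2 x2 -> exists2 x, D1 x & x2 = a * x + b * y1 x + e) ->
  exists (L : 'M[R]_2) (v : 'cV[R]_2),
    [/\ \det L = a * d - b * c, affine L v @` graph D1 y1 = graph D2 y2 &
      forall x y, affine L v (pt x y) =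
        pt (a * x + b * y + e) (c * x + d * y + f)].
Proof.
move=> m surj.
pose L : 'M[R]_2 := \matrix_(i, j)
  if val i == 0%N then if val j == 0%N then a else b
  else if val j == 0%N then c else d.
exists L, (pt e f); split.
- by rewrite det22 !mxE.
- by apply/image_graphP; rewrite !mxE.
- by move=> x y; rewrite affine_pt !mxE.
Qed.

Theorem corollary4p1 (R : realType) :
  (* invariance of the signature, of the arc parameter and of k(s) *)
  (forall (D1 : set R) (y1 : R -> R) (D2 : set R) (y2 : R -> R)
          (L : 'M[R]_2) (v : 'cV[R]_2),
     regular D1 y1 -> regular D2 y2 -> 0 < \det L ->
     affine L v @` graph D1 y1 = graph D2 y2 ->
     same_signature D1 y1 D2 y2 /\
     exists (s1 s2 : R -> R) (J : set R) (K : R -> R),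
       [/\ curvature_function D1 y1 s1 J K,
           curvature_function D2 y2 s2 J K &
           forall x1 x2 : R, D1 x1 -> D2 x2 ->
             affine L v (pt x1 (y1 x1)) = pt x2 (y2 x2) -> s1 x1 = s2 x2])
  /\
  (* k(s) and the signature determine the curve *)
  (forall (D1 : set R) (y1 : R -> R) (D2 : set R) (y2 : R -> R)
          (s1 s2 : R -> R) (J : set R) (K : R -> R),
     regular D1 y1 -> regular D2 y2 ->
     same_signature D1 y1 D2 y2 ->
     curvature_function D1 y1 s1 J K -> curvature_function D2 y2 s2 J K ->
     exists (L : 'M[R]_2) (v : 'cV[R]_2),
       0 < \det L /\ affine L v @` graph D1 y1 = graph D2 y2)
  /\
  (* for each signature, every differential invariant is a function of k and
     finitely many of its derivatives with respect to s *)
  (forall (r : nat) (F : 'rV[R]_r.+2 -> R), differential_invariant F ->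
   forall sigma : R, sigma = 1 \/ sigma = -1 ->
   exists (m : nat) (Phi : 'rV[R]_m -> R), smooth_on setT Phi /\
     forall (D : set R) (y : R -> R) (x : R),
       regular D y -> D x -> signature y x = sigma ->
       F (jet r y x) = Phi (curvature_derivatives m y x)).
Proof.
split; [|split].
- move=> D1 y1 D2 y2 L v reg1 reg2;
    rewrite det22 => det_gt0 /image_graphP[m surj].
  have [sg [s1 [s2 [J [K [c1 c2 sE]]]]]] := curvature_function_invariant reg1
    reg2 det_gt0 m surj.
  split; first exact: sg.
  exists s1, s2, J, K; split; [exact: c1|exact: c2|].
  by move=> x1 x2 Dx1 _; rewrite affine_pt => /pt_inj[<- _]; rewrite sE.
- move=> D1 y1 D2 y2 s1 s2 J K reg1 reg2 sg c1 c2.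
  have [a [b [c [d [e [f [det_gt0 m surj]]]]]]] := curvature_function_congruent
    reg1 reg2 sg c1 c2.
  have [L [v [LE imL _]]] := image_graph_exists m surj.
  by exists L, v; rewrite LE.
- move=> r F [sF invF] sigma sigmaE.
  exists r, (F \o fun k => normal_row sigma r (coord_or0 k)); split.
    apply/smooth_onTP => N; apply: diff_upto_comp sF _ _ => [j M|k].
      have -> : (fun k : 'rV[R]_r => normal_row sigma r (coord_or0 k) 0 j) =
          fun k => eval (coord_or0 k)
            (nth (Const 0) (normal_jet_expr sigma r) (val j).+1).
        by apply/funext => k; rewrite mxE.
      exact: diff_upto_eval.
    by apply: normal_row_regular; case: sigmaE => ->; rewrite ?oppr_eq0 oner_eq0.
  move=> D y x reg Dx <-; apply: (jet_normalization _ reg Dx) => [|j jr].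
    move=> D1 y1 D2 y2 a b c d e f x1 reg1 reg2 det_gt0 m surj Dx1.
    have [L [v [LE imL LvE]]] := image_graph_exists m surj.
    apply: (invF D1 y1 D2 y2 L v) => //; first by rewrite LE.
      exact: (m _ Dx1).1.
    by rewrite LvE (m _ Dx1).2.
  by rewrite /coord_or0 insubT mxE.
Qed.
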